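(* Let $p$ be a prime, $K$ a finite extension of $\mathbb{Q}_p$, and $A\subset K((\frac1T))$ a $K$-subalgebra with $A\cap K[[\frac1T]]=K$ and $\dim_KK((\frac1T))/(A+K[[\frac1T]])<\infty$, which is strictly integral. Let $b(T)\in O(A)\oplus\frac1TO_K[[\frac1T]]$ and $n\in\mathbb{Z}_{>0}$. If $c,\pi\in\mathcal{M}_K$ satisfy $|c|<|p^{n-1}|$ and $|\pi|\le|p|^{1/(p^n-p^{n-1})}$, then $$\Big[\exp\Big(c\sum_{k=0}^\infty\frac{\pi^{p^k}}{p^k}b(T)\Big)\Big]=1\quad\text{in }\Gamma_A.$$
   Context: $|\cdot|$ is the absolute value on $K$ with $|p|=1/p$, $O_K=\{|a|\le1\}$, $\mathcal{M}_K=\{|a|<1\}$. $K((\frac1T))$ is the field of series $\sum_{i\le n}v_iT^i$; the degree is the largest exponent with nonzero coefficient. Write $\{\deg v : 0\ne v\in A\}=\{s_1<s_2<\cdots\}$. The standard basis of $A$ is the unique basis $v_i=\sum_jv_{ij}T^j$ with $v_i$ monic of degree $s_i$ and $v_{i,s_j}=0$ for $i>j\ge1$; $A$ is strictly integral if all $v_{ij}\in O_K$. $O(A)$ is the set of elements of $A$ with all coefficients in $O_K$. $H:=\{\sum_{i\in\mathbb{Z}}a_iT^i : a_i\in K,\ \sup|a_i|<\infty,\ \lim_{i\to+\infty}|a_i|=0\}$, a field complete for $\|\sum a_iT^i\|=\sup|a_i|$. $A^{\mathrm{an}}$ is the closure of $A$ in $H$. For $0\le\rho<1$, $\Gamma_\rho:=\{h=\sum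 h_iT^i\in H^* : \|h\|=|h_0|=1,\ |h_i|\le\rho^i\ \forall i>0\}$, $\Gamma:=\bigcup_{0\le\rho<1}\Gamma_\rho$, $\Gamma_A:=\Gamma/\big(((A^{\mathrm{an}})^*\cap\Gamma)\Gamma_0\big)$; $[h]$ is the class of $h\in\Gamma$. The exponential is taken in $H$ (part of the assertion is that it converges to an element of $\Gamma$). *)

(* Defs.v *)
From HB Require Import structures.
From mathcomp Require Import all_boot all_order all_algebra all_field.
From mathcomp Require Import generic_quotient fraction.
From mathcomp Require Import all_classical all_reals exp.

Set Implicit Arguments.
Unset Strict Implicit.
Unset Printing Implicit Defensive.

Import Order.TTheory GRing.Theory Num.Theory.

Local Open Scope classical_set_scope.
Local Open Scope ring_scope.

(* Z_p is the inverse limit of the rings Z/p^n: an element is a coherent      *)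
(* sequence of residues.  The coherence condition also forces x_n < p^n.      *)
Record padic_int (p : nat) (p_pr : prime p) : Type := PadicInt {
  residue :> nat -> nat;
  residueP : forall n, (residue n.+1 %% p ^ n)%N = residue n }.

Section PadicInt.
Context (p : nat) (p_pr : prime p).
Local Notation Zp := (padic_int p_pr).
Implicit Types x y z : Zp.

HB.instance Definition _ := gen_eqMixin Zp.
HB.instance Definition _ := gen_choiceMixin Zp.

Lemma padic_int_eq x y : residue x =1 residue y -> x = y.
Proof.
case: x y => [f fP] [g gP] /= /funext efg; move: fP gP; rewrite efg => fP gP.
by congr PadicInt; apply: Prop_irrelevance.
Qed.

Lemma residue_mod x n : (x n %% p ^ n)%N = x n.
Proof. by rewrite -residueP modn_mod. Qed.

Lemma residue_modS x n : (x n.+1 = x n %[mod p ^ n])%N.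
Proof. by rewrite residueP residue_mod. Qed.

Lemma residue_modD x n m : (x (m + n)%N = x n %[mod p ^ n])%N.
Proof.
elim: m => [|m IHm]; first by [].
rewrite -IHm addSn -(modn_dvdm (x (m + n).+1) (dvdn_exp2l p (leq_addl m n))).
by rewrite residueP.
Qed.

Fact of_residues_subproof (f : nat -> nat) :
    (forall n, f n.+1 = f n %[mod p ^ n])%N ->
  forall n, ((f n.+1 %% p ^ n.+1) %% p ^ n)%N = (f n %% p ^ n)%N.
Proof. by move=> fP n; rewrite modn_dvdm ?fP // dvdn_exp2l. Qed.

Definition of_residues f fP : Zp := PadicInt p_pr (@of_residues_subproof f fP).

Fact padic_add_subproof x y n : (x n.+1 + y n.+1 = x n + y n %[mod p ^ n])%N.
Proof. by rewrite -modnDm !residue_modS modnDm. Qed.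
Definition padic_add x y := of_residues (padic_add_subproof x y).

Fact padic_mul_subproof x y n : (x n.+1 * y n.+1 = x n * y n %[mod p ^ n])%N.
Proof. by rewrite -modnMm !residue_modS modnMm. Qed.
Definition padic_mul x y := of_residues (padic_mul_subproof x y).

Fact padic_opp_subproof x n :
  (p ^ n.+1 - x n.+1 = p ^ n - x n %[mod p ^ n])%N.
Proof.
have lex m : (x m <= p ^ m)%N.
  by rewrite -residue_mod ltnW // ltn_mod expn_gt0 prime_gt0.
apply/eqP; rewrite -(eqn_modDr (x n)) subnK ?lex //.
rewrite -modnDmr -[(x n %% _)%N]residue_modS modnDmr subnK ?lex //.
by rewrite expnS modnMl modnn.
Qed.
Definition padic_opp x := of_residues (padic_opp_subproof x).

Definition padic_nat k : Zp := @of_residues (fun=> k) (fun=> erefl).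

Fact padic_addA : associative padic_add.
Proof. by move=> x y z; apply: padic_int_eq => n /=; rewrite modnDml modnDmr addnA. Qed.
Fact padic_addC : commutative padic_add.
Proof. by move=> x y; apply: padic_int_eq => n /=; rewrite addnC. Qed.
Fact padic_add0 : left_id (padic_nat 0) padic_add.
Proof. by move=> x; apply: padic_int_eq => n /=; rewrite mod0n add0n residue_mod. Qed.
Fact padic_addN : left_inverse (padic_nat 0) padic_opp padic_add.
Proof.
move=> x; apply: padic_int_eq => n /=; rewrite modnDml subnK ?modnn ?mod0n //.
by rewrite -residue_mod ltnW // ltn_mod expn_gt0 prime_gt0.
Qed.

HB.instance Definition _ :=
  GRing.isZmodule.Build Zp padic_addA padic_addC padic_add0 padic_addN.

Fact padic_mulA : associative padic_mul.
Proof. by move=> x y z; apply: padic_int_eq => n /=; rewrite modnMml modnMmr mulnA. Qed.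
Fact padic_mulC : commutative padic_mul.
Proof. by move=> x y; apply: padic_int_eq => n /=; rewrite mulnC. Qed.
Fact padic_mul1 : left_id (padic_nat 1) padic_mul.
Proof. by move=> x; apply: padic_int_eq => n /=; rewrite modnMml mul1n residue_mod. Qed.
Fact padic_mulD : left_distributive padic_mul padic_add.
Proof.
by move=> x y z; apply: padic_int_eq => n /=; rewrite modnMml modnDm mulnDl.
Qed.
Fact padic_1neq0 : padic_nat 1 != padic_nat 0.
Proof.
apply/eqP => /(congr1 (fun x : Zp => x 1%N)) /=.
by rewrite expn1 mod0n modn_small ?prime_gt1.
Qed.

HB.instance Definition _ := GRing.Zmodule_isComNzRing.Build Zp
  padic_mulA padic_mulC padic_mul1 padic_mulD padic_1neq0.

Definition padic_unit : {pred Zp} := fun x => `[< exists y, y * x = 1 >].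
Definition padic_inv x : Zp :=
  if pselect (exists y, y * x = 1) is left xU then sval (cid xU) else x.

Fact padic_mulV : {in padic_unit, left_inverse 1 padic_inv *%R}.
Proof.
move=> x; rewrite unfold_in => /asboolP xU; rewrite /padic_inv.
by case: pselect => // {}xU; case: cid.
Qed.
Fact padic_unitP x y : y * x = 1 -> padic_unit x.
Proof. by move=> yx; apply/asboolP; exists y. Qed.
Fact padic_inv_out : {in [predC padic_unit], padic_inv =1 id}.
Proof.
move=> x; rewrite !inE unfold_in => /asboolP xNU.
by rewrite /padic_inv; case: pselect.
Qed.

HB.instance Definition _ := GRing.ComNzRing_hasMulInverse.Build Zp
  padic_mulV padic_unitP padic_inv_out.

Lemma padic_neq0 x : x != 0 -> exists n, ~~ (p ^ n %| x n)%N.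
Proof.
move=> /eqP x0; apply: contrapT => xN; apply: x0; apply: padic_int_eq => n /=.
have [/eqP xn|xn] := boolP (p ^ n %| x n)%N; last by case: xN; exists n.
by rewrite mod0n -residue_mod xn.
Qed.

Fact padic_mulf_eq0 x y : x * y = 0 -> (x == 0) || (y == 0).
Proof.
move=> xy0; apply: contrapT => /negP; rewrite negb_or.
move=> /andP[/padic_neq0[n xn] /padic_neq0[m ym]].
have /eqP := congr1 (fun z : Zp => z (m + n)%N) xy0.
rewrite /= mod0n -/(dvdn _ _) => dxy.
have {}xn : ~~ (p ^ n %| x (m + n)%N)%N by rewrite /dvdn residue_modD.
have {}ym : ~~ (p ^ m %| y (m + n)%N)%N.
  by rewrite addnC /dvdn residue_modD.
have x_gt0 : (0 < x (m + n)%N)%N by case: (x _) xn => //; rewrite dvdn0.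
have y_gt0 : (0 < y (m + n)%N)%N by case: (y _) ym => //; rewrite dvdn0.
move: dxy xn ym; rewrite !pfactor_dvdn ?muln_gt0 ?x_gt0 // lognM // -!ltnNge.
move=> le_mn lt_n lt_m; have := leq_ltn_trans le_mn (leq_add lt_n (ltnW lt_m)).
by rewrite addnC ltnn.
Qed.

HB.instance Definition _ := GRing.ComUnitRing_isIntegral.Build Zp padic_mulf_eq0.

End PadicInt.

Notation padic p_pr := {fraction padic_int p_pr}.

Section PadicAbs.
Context (R : realType) (p : nat) (p_pr : prime p).

(* The image of x in Z/p^n is zero iff p^n divides x, so this is 1 / p^v(x).  *)
Definition padic_int_abs (x : padic_int p_pr) : R :=
  inf [set p%:R ^- n | n in [set n | x n = 0%N]].

Definition padic_abs (x : padic p_pr) : R :=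
  padic_int_abs (repr x).1 / padic_int_abs (repr x).2.

End PadicAbs.

(* Any absolute value on a finite extension of Q_p that restricts to the      *)
(* p-adic one is ultrametric, and there is exactly one.                       *)
Record is_padic_abs (R : realType) (p : nat) (p_pr : prime p)
    (K : fieldExtType (padic p_pr)) (abs : K -> R) : Prop := IsPadicAbs {
  abs_ge0 : forall x, 0 <= abs x;
  abs_eq0 : forall x, abs x = 0 <-> x = 0;
  absM : forall x y, abs (x * y) = abs x * abs y;
  abs_ultra : forall x y, abs (x + y) <= Num.max (abs x) (abs y);
  abs_extends : forall a : padic p_pr, abs a%:A = padic_abs R a }.

(* Both K((1/T)) and H are sets of two-sided formal series sum_i f_i T^i,     *)
(* i.e. of functions int -> K, with the convolution product: lmul on K((1/T)) *)
(* and smul on H.  The sum of two series is the pointwise one.                *)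
Section Series.
Context (R : realType) (K : fieldType) (abs : K -> R).
Implicit Types (f g h : int -> K) (A : set (int -> K)).

Definition K_cvg (u : nat -> K) (l : K) : Prop :=
  forall e : R, 0 < e -> exists N, forall n, (N <= n)%N -> abs (u n - l) < e.

(* The sum over all of int, as the limit of the sums over -N <= i < N.        *)
Definition zsum (u : int -> K) : K :=
  xget 0 [set l | K_cvg (fun N => \sum_(k < N) (u (Posz k) + u (Negz k))) l].

(* For f and g in H the terms of the sum tend to 0 in both directions.        *)
Definition smul f g : int -> K := fun n => zsum (fun i => f i * g (n - i)).

(* For Laurent series in 1/T the sum has finite support.                      *)
Definition lmul f g : int -> K :=
  fun n => \sum_(i \in [set: int]) f i * g (n - i).

Definition sconst (a : K) : int -> K := fun i => if i == 0 then a else 0.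
Definition sone : int -> K := sconst 1.
Definition sscale (a : K) f : int -> K := fun i => a * f i.
Definition spow f (m : nat) : int -> K := iter m (smul f) sone.

Definition O_K : set K := [set a | abs a <= 1].
Definition M_K : set K := [set a | abs a < 1].

(* K((1/T)), K[[1/T]] and (1/T) O_K[[1/T]] *)
Definition laurent : set (int -> K) :=
  [set f | exists n : int, forall i, n < i -> f i = 0].
Definition power_series : set (int -> K) :=
  [set f | forall i, 0 < i -> f i = 0].
Definition int_power_series_max : set (int -> K) :=
  [set f | (forall i, 0 <= i -> f i = 0) /\ forall i, O_K (f i)].

Definition has_degree f (d : int) : Prop :=
  f d != 0 /\ forall i, d < i -> f i = 0.

Definition subalgebra A : Prop :=
  [/\ A `<=` laurent, A sone,
      forall a f g, A f -> A g -> A (sscale a f + g) &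
      forall f g, A f -> A g -> A (lmul f g)].

Definition finite_codim A : Prop :=
  exists (m : nat) (e : 'I_m -> int -> K),
    (forall j, laurent (e j)) /\
    forall f, laurent f -> exists (a : 'I_m -> K) (g h : int -> K),
      [/\ A g, power_series h & f = \sum_j sscale (a j) (e j) + (g + h)].

Definition basis A (v : nat -> int -> K) : Prop :=
  [/\ forall i, A (v i),
      forall f, A f -> exists m (a : nat -> K),
        f = \sum_(i < m) sscale (a i) (v i) &
      forall m (a : nat -> K), \sum_(i < m) sscale (a i) (v i) = 0 ->
        forall i, (i < m)%N -> a i = 0].

(* s and v are indexed from 0: s i and v i are s_{i+1} and v_{i+1}.           *)
Definition standard_basis A (s : nat -> int) (v : nat -> int -> K) : Prop :=
  [/\ forall i j, (i < j)%N -> s i < s j,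
      range s = [set d | exists2 f, A f & has_degree f d],
      basis A v,
      forall i, has_degree (v i) (s i) /\ v i (s i) = 1 &
      forall i j, (j < i)%N -> v i (s j) = 0].

Definition strictly_integral A : Prop :=
  exists (s : nat -> int) (v : nat -> int -> K),
    standard_basis A s v /\ forall i j, O_K (v i j).

(* O(A) *)
Definition integral_part A : set (int -> K) :=
  [set f | A f /\ forall i, O_K (f i)].

Definition H : set (int -> K) :=
  [set f | (exists M : R, forall i, abs (f i) <= M) /\
           (forall e : R, 0 < e -> exists N : int,
              forall i, N <= i -> abs (f i) < e)].

(* Meaningful for bounded f only, in particular on H.                         *)
Definition snorm f : R := sup (range (fun i => abs (f i))).

Definition H_cvg (u : nat -> int -> K) (l : int -> K) : Prop :=
  [/\ forall n, H (u n), H l &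
      forall e : R, 0 < e ->
        exists N, forall n, (N <= n)%N -> snorm (u n - l) < e].

Definition H_has_sum (u : nat -> int -> K) (l : int -> K) : Prop :=
  H_cvg (fun N => \sum_(k < N) u k) l.

Definition H_has_exp f h : Prop :=
  H_has_sum (fun m => sscale (m`!%:R)^-1 (spow f m)) h.

(* A^an *)
Definition an A : set (int -> K) :=
  [set f | H f /\ forall e : R, 0 < e ->
     exists g, [/\ A g, H g & snorm (f - g) < e]].

Definition an_units A : set (int -> K) :=
  [set f | an A f /\ exists2 g, an A g & smul f g = sone].

Definition Gamma_ (rho : R) : set (int -> K) :=
  [set h | [/\ H h, h <> 0, snorm h = 1, abs (h 0) = 1 &
               forall i : int, 0 < i -> abs (h i) <= rho ^ i]].

Definition Gamma : set (int -> K) :=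
  \bigcup_(rho in [set rho : R | 0 <= rho < 1]) Gamma_ rho.

Definition Gamma_sub A : set (int -> K) :=
  [set smul a g | a in an_units A `&` Gamma & g in Gamma_ 0].

(* [h], as a coset: Gamma_A is the set of all Gamma_class A h with h in       *)
(* Gamma, and its neutral element is Gamma_class A sone.                      *)
Definition Gamma_class A h : set (int -> K) :=
  [set smul h u | u in Gamma_sub A].

End Series.

(* Main.v *)
Require Import Defs.
From HB Require Import structures.
From mathcomp Require Import all_boot all_order all_algebra all_field.
From mathcomp Require Import generic_quotient fraction.
From mathcomp Require Import all_classical all_reals exp.
From mathcomp Require Import zify ring lra.

(** Put [x = c * sum_k pi^(p^k) / p^k] and [r = |p|^(1/(p-1))].  The [k]-th term
has absolute value at most [r / |p|^(n-1)], with the extremal terms at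
[k = n-1] and [k = n], so [|x| <= s * r] with [s = |c| / |p|^(n-1) < 1].  Since
[|m!| >= r^m], the [m]-th term of [exp (x f)] has norm at most [s^m] as soon as
[f] has integral coefficients.  Writing [b = f + g] with [f] in [O(A)] and [g] in
[(1/T) O_K[[1/T]]], we get [exp (x b) = exp (x f) * exp (x g)].  The first factor
is a limit of elements of [A] with inverse [exp (- x f)], and its coefficient
at [T^i] only involves terms with [m >= i / deg f], which gives the geometric
decay required by [Gamma]; the second factor has no positive powers of [T] and
lies in [Gamma_0].  All limits exist because [K] is complete, being finite
dimensional over the complete field [Q_p]. *)

Set Implicit Arguments.
Unset Strict Implicit.
Unset Printing Implicit Defensive.

Import Order.TTheory GRing.Theory Num.Theory.

Local Open Scope classical_set_scope.
Local Open Scope ring_scope.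

(** * Ultrametric fields and sums over the integers *)

(** The bound on [pi] says [|pi|^(p^(n-1)) <= r], because [p^n - p^(n-1) = (p-1) p^(n-1)]. As
    [r^(p-1) = |p|], term [n-1+j] is at most [r^(p^j - (p-1)j) / |p|^(n-1)], whose exponent is 1 for
    [j = 0, 1] and larger afterwards. The strict bound on [c] puts [x] strictly inside the disc of
    radius [r], and the resulting ratio [s] controls every limit: truncating an exponential after
    [N] terms costs at most [s^N]. With this rate, [exp (F + G) = exp F * exp G] amounts to
    discarding the index pairs with [a + b >= N] from a finite square. The obstacle is algebraic:
    the product of [H] is a limit of partial sums over windows, so even associativity requires
    interchanging infinite sums. Once that is done, [H] becomes a commutative ring and the rest is
    ring algebra with norm estimates. On Q_p the absolute value is computed from chosen
    representatives of fractions; its ultrametric inequality is inherited from the one assumed on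
    [K]. *)

Definition K_cauchy (R : realType) (K : fieldType) (abs : K -> R)
    (u : nat -> K) : Prop :=
  forall e : R, 0 < e ->
    exists N, forall m n, (N <= m)%N -> (N <= n)%N -> abs (u m - u n) < e.

(** This is all that the analysis in [H] uses of [K]; it is established for finite extensions of Q_p
    only later. *)
Record complete_ultra (R : realType) (K : fieldType) (abs : K -> R) : Prop :=
  CompleteUltra {
    cu_ge0 : forall x, 0 <= abs x;
    cu_eq0 : forall x, abs x = 0 <-> x = 0;
    cu_M : forall x y, abs (x * y) = abs x * abs y;
    cu_D : forall x y, abs (x + y) <= Num.max (abs x) (abs y);
    cu_complete : forall u, K_cauchy abs u -> exists l, K_cvg abs u l }.

Section Ultra.
Context (R : realType) (K : fieldType) (abs : K -> R).
Hypothesis abs_ge0 : forall x, 0 <= abs x.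
Hypothesis abs_eq0 : forall x, abs x = 0 <-> x = 0.
Hypothesis absM : forall x y, abs (x * y) = abs x * abs y.
Hypothesis absD : forall x y, abs (x + y) <= Num.max (abs x) (abs y).

Lemma ultra0 : abs 0 = 0. Proof. exact/abs_eq0. Qed.

Lemma ultra1 : abs 1 = 1.
Proof.
have /eqP := absM 1 1; rewrite mulr1 -subr_eq0 -{1}[abs 1]mulr1 -mulrBr mulf_eq0.
rewrite subr_eq0 => /orP[/eqP/abs_eq0/eqP|/eqP//]; by rewrite oner_eq0.
Qed.

Lemma ultraN x : abs (- x) = abs x.
Proof.
have h : abs (-1) = 1.
  have := absM (-1) (-1); rewrite mulrNN mulr1 ultra1 => /esym/eqP.
  by rewrite -expr2 sqrf_eq1 => /orP[/eqP//|/eqP hh]; have := abs_ge0 (-1); lra.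
by rewrite -mulN1r absM h mul1r.
Qed.

Lemma ultra_distC x y : abs (x - y) = abs (y - x).
Proof. by rewrite -ultraN opprB. Qed.

Lemma ultra_le x y e : abs x <= e -> abs y <= e -> abs (x + y) <= e.
Proof. by move=> hx hy; apply: le_trans (absD _ _) _; rewrite ge_max hx. Qed.

Lemma ultra_lt x y e : abs x < e -> abs y < e -> abs (x + y) < e.
Proof. by move=> hx hy; apply: le_lt_trans (absD _ _) _; rewrite gt_max hx. Qed.

Lemma ultra_dist y x z e : abs (x - y) <= e -> abs (y - z) <= e -> abs (x - z) <= e.
Proof. by move=> hx hy; rewrite -(subrKA y); apply: ultra_le. Qed.

Lemma ultra_dist_lt y x z e : abs (x - y) < e -> abs (y - z) < e -> abs (x - z) < e.
Proof. by move=> hx hy; rewrite -(subrKA y); apply: ultra_lt. Qed.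

Lemma ultra_sum (I : Type) (r : seq I) (P : pred I) (F : I -> K) e :
  0 <= e -> (forall i, P i -> abs (F i) <= e) -> abs (\sum_(i <- r | P i) F i) <= e.
Proof.
move=> e0 h; apply: (big_ind (fun x => abs x <= e)) => //; first by rewrite ultra0.
by move=> x y; apply: ultra_le.
Qed.

Lemma ultra_sum_in (I : eqType) (r : seq I) (F : I -> K) e :
  0 <= e -> (forall i, i \in r -> abs (F i) <= e) -> abs (\sum_(i <- r) F i) <= e.
Proof. by move=> e0 h; rewrite big_seq; apply: ultra_sum. Qed.

Lemma ultraX x n : abs (x ^+ n) = abs x ^+ n.
Proof. by elim: n => [|n IH]; rewrite ?expr0 ?ultra1 // !exprS absM IH. Qed.

Lemma ultra_gt0 x : (0 < abs x) = (x != 0).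
Proof.
rewrite lt_neqAle abs_ge0 andbT eq_sym; congr negb.
by apply/eqP/eqP => /abs_eq0.
Qed.

Lemma ultraV x : abs x^-1 = (abs x)^-1.
Proof.
have [->|x0] := eqVneq x 0; first by rewrite invr0 ultra0 invr0.
have a0 : abs x != 0 by rewrite gt_eqF // ultra_gt0.
by apply: (mulfI a0); rewrite -absM !divff // ultra1.
Qed.

(** The isosceles triangle principle; it later identifies constant coefficients of absolute value
    1. *)
Lemma ultra_eq x y : abs (x - y) < abs x -> abs y = abs x.
Proof.
move=> h; apply/eqP; rewrite eq_le; apply/andP; split.
  have -> : y = x + - (x - y) by ring.
  by apply: ultra_le => //; rewrite ultraN ltW.
rewrite leNgt; apply/negP => hy; have : abs x < abs x; last by rewrite ltxx.
by rewrite -{1}[x](subrK y); apply: ultra_lt.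
Qed.

Lemma ultra_nat n : abs n%:R <= 1.
Proof.
elim: n => [|n IH]; first by rewrite ultra0 ler01.
by rewrite -natr1; apply: ultra_le => //; rewrite ultra1.
Qed.

(** A Bezout relation [a m = b p + 1] would give [|1| < 1] if [|m| < 1]. *)
Lemma ultra_coprime p m : abs p%:R < 1 -> (0 < m)%N -> coprime m p -> abs m%:R = 1.
Proof.
move=> p1 m0 cmp; apply/eqP; rewrite eq_le ultra_nat leNgt; apply/negP => m1.
have [a b e _] := egcdnP p m0.
move: e; rewrite (eqP cmp) => e.
have : abs 1 < 1; last by rewrite ultra1 ltxx.
have -> : 1 = a%:R * m%:R + - (b%:R * p%:R) :> K.
  by rewrite -!natrM e natrD addrAC subrr add0r.
by apply: ultra_lt; rewrite ?ultraN absM;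
  [apply: le_lt_trans m1|apply: le_lt_trans p1]; rewrite ler_piMl ?ultra_nat.
Qed.

Lemma ultra_le_lim u l a e (N : nat) :
  K_cvg abs u l -> (forall n, (N <= n)%N -> abs (u n - a) <= e) -> abs (l - a) <= e.
Proof.
move=> ul h; rewrite leNgt; apply/negP => he.
have d0 : 0 < abs (l - a) by apply: le_lt_trans he; apply: le_trans (h N (leqnn _)).
have [M hM] := ul _ d0.
have : abs (l - a) < abs (l - a); last by rewrite ltxx.
have := hM (maxn M N) (leq_maxl _ _); rewrite ultra_distC => h1.
by apply: ultra_dist_lt h1 _; apply: le_lt_trans he; apply: h; apply: leq_maxr.
Qed.

Lemma K_cvg_unique u l l' : K_cvg abs u l -> K_cvg abs u l' -> l = l'.
Proof.
move=> h h'; apply/eqP; rewrite -subr_eq0; apply/eqP/abs_eq0/eqP.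
rewrite eq_le abs_ge0 andbT leNgt; apply/negP => e0.
have [N hN] := h _ e0; have [M hM] := h' _ e0.
have : abs (l - l') < abs (l - l'); last by rewrite ltxx.
have h1 := hN (maxn N M) (leq_maxl _ _); have h2 := hM (maxn N M) (leq_maxr _ _).
by move: h1; rewrite ultra_distC => h1; apply: ultra_dist_lt h1 h2.
Qed.

Lemma K_cvg_cauchy u l : K_cvg abs u l -> K_cauchy abs u.
Proof.
move=> h e e0; have [N hN] := h _ e0; exists N => m n Nm Nn.
by apply: (@ultra_dist_lt l); [apply: hN|rewrite ultra_distC; apply: hN].
Qed.

End Ultra.

(** These are the indices of the [N]-th partial sum in [zsum], kept as a duplicate-free list so that
    it can be compared with a sum over any other finite list. *)
Definition zwin N : seq int :=
  [seq Posz k | k <- iota 0 N] ++ [seq Negz k | k <- iota 0 N].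

Lemma zwin_uniq N : uniq (zwin N).
Proof.
rewrite cat_uniq !map_inj_uniq ?iota_uniq ?andbT; do ?by move=> ? ? [].
by apply/hasPn => i /mapP[k _ ->]; apply/negP => /mapP[].
Qed.

Lemma zwin_sub (s : seq int) : exists N, forall M, (N <= M)%N -> {subset s <= zwin M}.
Proof.
elim: s => [|i s [N hN]]; first by exists 0%N.
exists (maxn N (absz i).+1) => M; rewrite geq_max => /andP[NM iM] j.
rewrite inE => /orP[/eqP->|js]; last by apply: (hN M).
rewrite mem_cat; case: i iM => k /= kM; apply/orP; [left|right];
  by apply: map_f; rewrite mem_iota /= add0n ?(ltnW kM).
Qed.

Lemma big_zwin (V : nmodType) (u : int -> V) N :
  \sum_(k < N) (u (Posz k) + u (Negz k)) = \sum_(i <- zwin N) u i.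
Proof.
rewrite big_split /= big_cat /= !big_map.
rewrite -(big_mkord xpredT (u \o Posz)) -(big_mkord xpredT (u \o Negz)).
by rewrite /index_iota subn0.
Qed.

Lemma big_subset_uniq (V : nmodType) (I : eqType) (u : I -> V) (s t : seq I) :
  uniq s -> uniq t -> {subset s <= t} ->
  \sum_(i <- t) u i = \sum_(i <- s) u i + \sum_(i <- t | i \notin s) u i.
Proof.
move=> us ut st; rewrite (bigID (mem s)) /=; congr (_ + _).
rewrite -big_filter; apply: perm_big; apply: uniq_perm => //; first exact: filter_uniq.
move=> i; rewrite mem_filter; case: (boolP (i \in s)) => // /st -> //.
Qed.

Section ZSum.
Context (R : realType) (K : fieldType) (abs : K -> R) (cu : complete_ultra abs).
Let abs_ge0 := cu_ge0 cu.
Let abs_eq0 := cu_eq0 cu.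
Let absM := cu_M cu.
Let absD := cu_D cu.
Let ul0 := ultra0 abs_eq0.
Let ulC := ultra_distC abs_ge0 abs_eq0 absM.
Let ulle := @ultra_le _ _ _ absD.
Let uldist := @ultra_dist _ _ _ absD.

(** Convergence to 0 along the complements of finite sets: over a complete ultrametric field this
    yields summability independent of the order of the terms. *)
Definition null (u : int -> K) : Prop :=
  forall e : R, 0 < e -> exists s : seq int, forall i, i \notin s -> abs (u i) <= e.

Lemma zsum_cvg u : null u -> K_cvg abs (fun N => \sum_(i <- zwin N) u i) (zsum abs u).
Proof.
move=> nu; have -> : (fun N => \sum_(i <- zwin N) u i) =
    (fun N => \sum_(k < N) (u (Posz k) + u (Negz k))).
  by apply/funext => N; rewrite big_zwin.
apply: (xgetPex 0 (P := [set l | K_cvg abs _ l])); apply: (cu_complete cu) => e e0.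
have e20 : 0 < e / 2 by lra.
have [s hs] := nu _ e20; have [N hN] := zwin_sub s.
exists N => m n Nm Nn; rewrite !big_zwin; apply: (@le_lt_trans _ _ (e / 2)); last lra.
have key M : (N <= M)%N ->
    abs (\sum_(i <- zwin M) u i - \sum_(i <- undup s) u i) <= e / 2.
  move=> NM; rewrite (@big_subset_uniq _ _ _ (undup s)) ?undup_uniq ?zwin_uniq //;
    last first.
    by move=> i; rewrite mem_undup; apply: hN.
  rewrite addrC addKr; apply: (ultra_sum abs_eq0 absD); first exact: ltW.
  by move=> i; rewrite mem_undup; apply: hs.
by apply: uldist (key m Nm) _; rewrite ulC; apply: key.
Qed.

(** Any window containing [s] adds only terms of size at most [e], and closed balls are stable under
    limits. With [dist_eq], this reduces each identity between infinite sums to one between finite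
    sums. *)
Lemma zsum_approx u s e : null u -> 0 <= e -> uniq s ->
  (forall i, i \notin s -> abs (u i) <= e) ->
  abs (zsum abs u - \sum_(i <- s) u i) <= e.
Proof.
move=> nu e0 us h; have [N hN] := zwin_sub s.
apply: (ultra_le_lim abs_ge0 abs_eq0 absM absD (N := N) (zsum_cvg nu)) => M NM.
rewrite (big_subset_uniq u us) ?zwin_uniq //; last exact: hN.
by rewrite addrC addKr; apply: (ultra_sum abs_eq0 absD).
Qed.

Lemma zsum_le u e : null u -> 0 <= e -> (forall i, abs (u i) <= e) ->
  abs (zsum abs u) <= e.
Proof.
move=> nu e0 h; have := @zsum_approx u [::] e nu e0 isT (fun i _ => h i).
by rewrite big_nil subr0.
Qed.

Lemma dist_eq (x y : K) : (forall e, 0 < e -> abs (x - y) <= e) -> x = y.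
Proof.
move=> h; apply/eqP; rewrite -subr_eq0; apply/eqP/abs_eq0/eqP.
rewrite eq_le abs_ge0 andbT leNgt; apply/negP => e0.
have e2 : 0 < abs (x - y) / 2 by lra.
by have := h _ e2; lra.
Qed.

Lemma null_uniq u e : null u -> 0 < e ->
  exists2 s : seq int, uniq s & forall i, i \notin s -> abs (u i) <= e.
Proof.
move=> nu e0; have [s hs] := nu _ e0; exists (undup s); first exact: undup_uniq.
by move=> i; rewrite mem_undup; apply: hs.
Qed.

Lemma zsum_finite u s : uniq s -> (forall i, i \notin s -> u i = 0) ->
  zsum abs u = \sum_(i <- s) u i.
Proof.
move=> us h; apply: dist_eq => e e0.
have nu : null u by move=> d d0; exists s => i /h ->; rewrite ul0 ltW.
by apply: zsum_approx => //; [exact: ltW|move=> i /h ->; rewrite ul0 ltW].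
Qed.

Lemma nullD u v : null u -> null v -> null (fun i => u i + v i).
Proof.
move=> nu nv e e0; have [s hs] := nu _ e0; have [t ht] := nv _ e0.
exists (s ++ t) => i; rewrite mem_cat negb_or => /andP[/hs h1 /ht h2]; exact: ulle.
Qed.

Lemma nullZ a u : null u -> null (fun i => a * u i).
Proof.
(* Dividing by [abs a + 1] rather than [abs a] also covers [a = 0]. *)
move=> nu e e0; have a1 : 0 < abs a + 1 by have := abs_ge0 a; lra.
have [s hs] := nu _ (divr_gt0 e0 a1); exists s => i /hs h.
have := ler_pM (abs_ge0 a) (abs_ge0 _) (_ : abs a <= abs a + 1) h.
rewrite absM mulrCA divff ?mulr1 ?gt_eqF //; apply; lra.
Qed.

Lemma zsumD u v : null u -> null v ->
  zsum abs (fun i => u i + v i) = zsum abs u + zsum abs v.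
Proof.
move=> nu nv; apply: dist_eq => e e0.
have [s us hs] := null_uniq nu e0; have [t ut ht] := null_uniq nv e0.
have hr : forall i, i \notin undup (s ++ t) -> abs (u i) <= e /\ abs (v i) <= e.
  by move=> i; rewrite mem_undup mem_cat negb_or => /andP[/hs h1 /ht h2].
have ur := undup_uniq (s ++ t); move: (undup _) hr ur => r hr ur.
have e0' := ltW e0.
apply: (@uldist (\sum_(i <- r) (u i + v i))).
  by apply: zsum_approx => //; [exact: nullD|move=> i /hr[]; apply: ulle].
rewrite big_split /= opprD addrACA; apply: ulle.
  by rewrite ulC; apply: zsum_approx => // i /hr[].
by rewrite ulC; apply: zsum_approx => // i /hr[].
Qed.

Lemma zsumZ a u : null u -> zsum abs (fun i => a * u i) = a * zsum abs u.
Proof.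
move=> nu; apply: dist_eq => e e0.
have a1 : 0 < abs a + 1 by have := abs_ge0 a; lra.
have d0 := divr_gt0 e0 a1; have [s us hs] := null_uniq nu d0.
have hm x : abs x <= e / (abs a + 1) -> abs (a * x) <= e.
  move=> h; have := ler_pM (abs_ge0 a) (abs_ge0 _) (_ : abs a <= abs a + 1) h.
  rewrite absM mulrCA divff ?mulr1 ?gt_eqF //; apply; lra.
apply: (@uldist (\sum_(i <- s) (a * u i))).
  apply: zsum_approx => //; [exact: nullZ|exact: ltW|by move=> i /hs; apply: hm].
rewrite -mulr_sumr -mulrBr; apply: hm; rewrite ulC; apply: zsum_approx => //.
exact: ltW.
Qed.

(** The windows defining [zsum] are not stable under a bijection of the integers; comparing both
    sums with the same finite sum avoids the windows. *)
Lemma zsum_reindex (f g : int -> int) u : cancel f g -> cancel g f ->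
  null u -> zsum abs (fun i => u (f i)) = zsum abs u.
Proof.
move=> fK gK nu; apply: dist_eq => e e0.
have nf : null (fun i => u (f i)).
  move=> d d0; have [s hs] := nu _ d0; exists (map g s) => i hi; apply: hs.
  by apply: contra hi => hi; rewrite -[i]fK map_f.
have [s us hs] := null_uniq nu e0; have e0' := ltW e0.
apply: (@uldist (\sum_(i <- s) u i)); last by rewrite ulC; apply: zsum_approx.
have -> : \sum_(i <- s) u i = \sum_(i <- map g s) u (f i).
  by rewrite big_map; apply: eq_bigr => i _; rewrite gK.
apply: zsum_approx => //; first by rewrite map_inj_uniq //; apply: can_inj gK.
by move=> i hi; apply: hs; apply: contra hi => hi; rewrite -[i]fK map_f.
Qed.

(** Smallness outside one finite square, which is the uniformity in both indices that an interchange
    of sums needs. *)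
Definition null2 (u : int -> int -> K) : Prop :=
  forall e : R, 0 < e -> exists s : seq int,
    forall i j, ~~ ((i \in s) && (j \in s)) -> abs (u i j) <= e.

Lemma null2_row u i : null2 u -> null (u i).
Proof.
move=> nu e e0; have [s hs] := nu _ e0; exists s => j js; apply: hs.
by rewrite (negbTE js) andbF.
Qed.

Lemma null2_sum u : null2 u -> null (fun i => zsum abs (u i)).
Proof.
move=> nu e e0; have [s hs] := nu _ e0; exists s => i si.
apply: zsum_le; [exact: null2_row|exact: ltW|move=> j; apply: hs].
by rewrite (negbTE si).
Qed.

Lemma zsum_exchange u : null2 u ->
  zsum abs (fun i => zsum abs (fun j => u i j)) =
  zsum abs (fun j => zsum abs (fun i => u i j)).
Proof.
move=> nu.
have nu' : null2 (fun i j => u j i).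
  by move=> e e0; have [s hs] := nu _ e0; exists s => i j; rewrite andbC; apply: hs.
apply: dist_eq => e e0; have e0' := ltW e0; have [s hs] := nu _ e0.
have hr : forall i j, ~~ ((i \in undup s) && (j \in undup s)) -> abs (u i j) <= e.
  by move=> i j; rewrite !mem_undup; apply: hs.
have ur := undup_uniq s; move: (undup s) hr ur => r hr ur.
(* Each iterated sum is within [e] of the finite double sum over the square [r * r]. Stated for
   arbitrary [v], this applies to [u] and to its transpose. *)
have key v : null2 v ->
    (forall i j, ~~ ((i \in r) && (j \in r)) -> abs (v i j) <= e) ->
    abs (zsum abs (fun i => zsum abs (fun j => v i j)) -
         \sum_(i <- r) \sum_(j <- r) v i j) <= e.
  move=> nv hv; apply: (@uldist (\sum_(i <- r) zsum abs (v i))).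
    apply: zsum_approx => //; first exact: null2_sum.
    move=> i ir; apply: zsum_le => //; first exact: null2_row.
    by move=> j; apply: hv; rewrite (negbTE ir).
  rewrite -sumrB; apply: (ultra_sum abs_eq0 absD) => // i _.
  apply: zsum_approx => //; first exact: null2_row.
  by move=> j jr; apply: hv; rewrite (negbTE jr) andbF.
apply: uldist (key _ nu hr) _; rewrite exchange_big /= ulC; apply: key => //.
by move=> i j; rewrite andbC; apply: hr.
Qed.

End ZSum.

(** * The ring H *)

Lemma zwinPn N (i : int) : i \notin zwin N -> (N <= absz i)%N.
Proof.
rewrite mem_cat negb_or => /andP[h1 h2]; rewrite leqNgt; apply/negP => iN.
case: i iN h1 h2 => k /= kN.
  by rewrite map_f // mem_iota.
by rewrite [_ \in map Negz _]map_f // mem_iota /= add0n ltnW.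
Qed.

Section HSeries.
Context (R : realType) (K : fieldType) (abs : K -> R) (cu : complete_ultra abs).
Let abs_ge0 := cu_ge0 cu.
Let abs_eq0 := cu_eq0 cu.
Let absM := cu_M cu.
Let absD := cu_D cu.
Let ul0 := ultra0 abs_eq0.
Let ulN := ultraN abs_ge0 abs_eq0 absM.
Let ulle := @ultra_le _ _ _ absD.
Implicit Types f g h : int -> K.
Local Notation H := (H abs).
Local Notation smul := (smul abs).
Local Notation zsum := (zsum abs).
Local Notation null := (null abs).

Lemma H_bounded f : H f -> exists2 M : R, 1 <= M & forall i, abs (f i) <= M.
Proof.
move=> [[M hM] _]; exists (Num.max 1 M); first by rewrite le_max lexx.
by move=> i; rewrite le_max hM orbT.
Qed.

Lemma H_small f e : H f -> 0 < e ->
  exists N0 : nat, forall i : int, (N0%:Z <= i)%R -> abs (f i) <= e.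
Proof.
move=> [_ hf] e0; have [N hN] := hf _ e0; exists (absz N) => i hi.
apply/ltW/hN; lia.
Qed.

Lemma prod_small (e M a b : R) : 0 < e -> 1 <= M -> 0 <= a -> 0 <= b ->
  a <= e / M -> b <= M -> a * b <= e /\ b * a <= e.
Proof.
move=> e0 M1 a0 b0 ae bM; rewrite (mulrC b).
have := ler_pM a0 b0 ae bM; rewrite divfK //.
by rewrite gt_eqF //; lra.
Qed.

(** Elements of [H] are small only towards [+oo] and merely bounded towards [-oo]. For [i] large
    [f i] is small; for [i] very negative [n - i] is large and [g (n - i)] is small. *)
Lemma conv_null f g (n : int) : H f -> H g -> null (fun i => f i * g (n - i)).
Proof.
move=> Hf Hg e e0; have [M M1 fM] := H_bounded Hf; have [M' M1' gM] := H_bounded Hg.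
have d0 : 0 < e / M by apply: divr_gt0 => //; lra.
have d0' : 0 < e / M' by apply: divr_gt0 => //; lra.
have [N hN] := H_small Hf d0'; have [N' hN'] := H_small Hg d0.
exists (zwin (N + N' + absz n)) => i /zwinPn hi; rewrite absM.
have [Ni|iN] := lerP N%:Z i.
  by have [] := @prod_small e M' _ _ e0 M1' (abs_ge0 _) (abs_ge0 _) (hN _ Ni) (gM (n - i)).
have Ni : N'%:Z <= n - i by lia.
by have [] := @prod_small e M _ _ e0 M1 (abs_ge0 _) (abs_ge0 _) (hN' _ Ni) (fM i).
Qed.

(** The three indices [i], [k - i], [n - k] have constant sum [n], so outside a large square one of
    them is large and its factor is small. *)
Lemma conv_null2 f g h (n : int) : H f -> H g -> H h ->
  null2 abs (fun k i => f i * g (k - i) * h (n - k)).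
Proof.
move=> Hf Hg Hh e e0.
have [M1 h1 fM] := H_bounded Hf; have [M2 h2 gM] := H_bounded Hg.
have [M3 h3 hM] := H_bounded Hh.
(* As each bound is at least 1, [M] dominates the product of any two of them, whichever factor is
   the small one. *)
pose M := M1 * M2 * M3.
have MM : [/\ M1 * M2 <= M, M1 * M3 <= M, M2 * M3 <= M & 1 <= M].
  have ge1 (a b : R) : 1 <= a -> 1 <= b -> 1 <= a * b by move=> ? ?; nra.
  have le1 (a b : R) : 1 <= a -> 1 <= b -> a <= a * b by move=> ? ?; nra.
  split; rewrite /M; [|rewrite [M1 * M2 * _]mulrAC|rewrite -mulrA [M1 * _]mulrC|].
  - exact: le1 (ge1 _ _ h1 h2) h3.
  - exact: le1 (ge1 _ _ h1 h3) h2.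
  - exact: le1 (ge1 _ _ h2 h3) h1.
  - exact: ge1 (ge1 _ _ h1 h2) h3.
have [m1 m2 m3 m0] := MM.
have d0 : 0 < e / M by apply: divr_gt0 => //; lra.
have [N1 hN1] := H_small Hf d0; have [N2 hN2] := H_small Hg d0.
have [N3 hN3] := H_small Hh d0.
exists (zwin (N1 + N2 + N3 + absz n)) => k i hki; rewrite !absM.
have a1 := abs_ge0 (f i); have a2 := abs_ge0 (g (k - i)).
have a3 := abs_ge0 (h (n - k)).
have b1 := fM i; have b2 := gM (k - i); have b3 := hM (n - k).
have mm u v U V : 0 <= u -> 0 <= v -> u <= U -> v <= V -> U * V <= M -> u * v <= M.
  by move=> u0 v0 uU vV; apply: le_trans; apply: ler_pM.
have [Ni|iN] := lerP N1%:Z i.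
  rewrite -mulrA; apply: (proj1 (@prod_small e M _ _ _ _ _ _ (hN1 _ Ni) _)) => //.
    exact: mulr_ge0.
  exact: mm m3.
have [Nki|kiN] := lerP N2%:Z (k - i).
  rewrite [abs (f i) * _]mulrC -mulrA.
  apply: (proj1 (@prod_small e M _ _ _ _ _ _ (hN2 _ Nki) _)) => //.
    exact: mulr_ge0.
  exact: mm m2.
have Nnk : N3%:Z <= n - k.
  move: hki iN kiN; rewrite negb_and; clear; case/orP=> /zwinPn; lia.
apply: (proj2 (@prod_small e M _ _ _ _ _ _ (hN3 _ Nnk) _)) => //.
  exact: mulr_ge0.
exact: mm m1.
Qed.

Lemma H_sconst a : H (sconst a).
Proof.
split; first by exists (abs a) => i; rewrite /sconst; case: ifP => // _; rewrite ul0.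
by move=> e e0; exists 1 => i i1; rewrite /sconst; case: eqP => [|_]; [lia|rewrite ul0].
Qed.

Lemma H_add f g : H f -> H g -> H (f + g).
Proof.
move=> Hf Hg; have [M _ fM] := H_bounded Hf; have [M' _ gM] := H_bounded Hg; split.
  exists (Num.max M M') => i; apply: ulle; by rewrite le_max ?fM ?gM ?orbT.
move=> e e0; have e2 : 0 < e / 2 by lra.
have [N hN] := H_small Hf e2; have [N' hN'] := H_small Hg e2.
exists (Posz (maxn N N')) => i hi; apply: (@le_lt_trans _ _ (e / 2)); last lra.
apply: ulle; [apply: hN|apply: hN']; lia.
Qed.

Lemma H_opp f : H f -> H (- f).
Proof.
move=> [[M fM] hf]; split; first by exists M => i; rewrite [(- f) i]/= ulN.
by move=> e /hf[N hN]; exists N => i /hN; rewrite [(- f) i]/= ulN.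
Qed.

Lemma smul_le f g B n : H f -> H g -> 0 <= B ->
  (forall i, abs (f i) * abs (g (n - i)) <= B) -> abs (smul f g n) <= B.
Proof.
move=> Hf Hg B0 h; apply: (zsum_le cu) => //; first exact: conv_null.
by move=> i; rewrite absM.
Qed.

Lemma H_smul f g : H f -> H g -> H (smul f g).
Proof.
move=> Hf Hg; have [M M1 fM] := H_bounded Hf; have [M' M1' gM] := H_bounded Hg; split.
  exists (M * M') => n; apply: smul_le => //; first by nra.
  by move=> i; apply: ler_pM.
move=> e e0; have e2 : 0 < e / 2 by lra.
have d0 : 0 < e / 2 / M by apply: divr_gt0 => //; lra.
have d0' : 0 < e / 2 / M' by apply: divr_gt0 => //; lra.
have [N hN] := H_small Hf d0'; have [N' hN'] := H_small Hg d0.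
(* If [n >= N + N'], then [i >= N] or [n - i >= N'] for every [i], so each term has a small
   factor. *)
exists (Posz (N + N')) => n hn; apply: (@le_lt_trans _ _ (e / 2)); last lra.
apply: smul_le => //; [exact: ltW|move=> i].
have [Ni|iN] := lerP N%:Z i.
  by have [] := @prod_small (e/2) M' _ _ e2 M1' (abs_ge0 _) (abs_ge0 _) (hN _ Ni) (gM (n - i)).
have Ni : N'%:Z <= n - i by lia.
by have [] := @prod_small (e/2) M _ _ e2 M1 (abs_ge0 _) (abs_ge0 _) (hN' _ Ni) (fM i).
Qed.

Lemma smulC f g : H f -> H g -> smul f g = smul g f.
Proof.
move=> Hf Hg; apply/funext => n; rewrite /smul.
rewrite -(@zsum_reindex _ _ _ cu (fun i => n - i) (fun i => n - i)); last 3 first.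
- by move=> i; lia.
- by move=> i; lia.
- exact: conv_null.
by congr Defs.zsum; apply/funext => i; rewrite mulrC; congr (g _ * _); lia.
Qed.

Lemma smulDl f g h : H f -> H g -> H h -> smul (f + g) h = smul f h + smul g h.
Proof.
move=> Hf Hg Hh; apply/funext => n; rewrite /smul.
rewrite -[RHS](zsumD cu); [|exact: conv_null|exact: conv_null].
by congr Defs.zsum; apply/funext => i; rewrite -mulrDl.
Qed.

Lemma smul_const a f : smul (sconst a) f = sscale a f.
Proof.
apply/funext => n; rewrite /smul (zsum_finite cu (s := [:: 0])) //.
  by rewrite big_seq1 /sconst eqxx subr0.
by move=> i; rewrite inE /sconst => /negbTE ->; rewrite mul0r.
Qed.

(** Shifting the inner index by [i] on the left makes both sides iterated sums of
    [f i * g (k - i) * h (n - k)], taken in opposite orders. *)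
Lemma smulA f g h : H f -> H g -> H h -> smul f (smul g h) = smul (smul f g) h.
Proof.
move=> Hf Hg Hh; apply/funext => n; rewrite /smul.
have n2 := conv_null2 n Hf Hg Hh.
transitivity (zsum (fun i => zsum (fun k => f i * g (k - i) * h (n - k)))).
  congr Defs.zsum; apply/funext => i; rewrite -(zsumZ cu); last exact: conv_null.
  rewrite -(@zsum_reindex _ _ _ cu (fun k => k - i) (fun k => k + i)); last 3 first.
  - by move=> k; lia.
  - by move=> k; lia.
  - exact/(nullZ cu)/conv_null.
  by congr Defs.zsum; apply/funext => k; rewrite mulrA; congr (_ * h _); lia.
rewrite -(zsum_exchange cu n2); congr Defs.zsum; apply/funext => k.
rewrite mulrC -(zsumZ cu); last exact: conv_null.
by congr Defs.zsum; apply/funext => i; rewrite mulrC.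
Qed.

End HSeries.

(* The parameter [cu] lets the ring structure be inferred from the type. *)
Record Hser (R : realType) (K : fieldType) (abs : K -> R)
    (cu : complete_ultra abs) : Type := HSer {
  hcoef :> int -> K;
  hcoefP : H abs hcoef }.

Section HRing.
Context (R : realType) (K : fieldType) (abs : K -> R) (cu : complete_ultra abs).
Local Notation HT := (Hser cu).
Implicit Types F G : HT.

HB.instance Definition _ := gen_eqMixin HT.
HB.instance Definition _ := gen_choiceMixin HT.

Lemma hcoef_inj : injective (@hcoef _ _ _ cu).
Proof.
move=> [f Hf] [g Hg] /= e; move: Hf; rewrite e => Hf.
by congr HSer; apply: Prop_irrelevance.
Qed.

Definition hconst a : HT := HSer cu (H_sconst cu a).
Definition hadd F G : HT := HSer cu (H_add cu (hcoefP F) (hcoefP G)).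
Definition hopp F : HT := HSer cu (H_opp cu (hcoefP F)).
Definition hmul F G : HT := HSer cu (H_smul cu (hcoefP F) (hcoefP G)).

Fact haddA : associative hadd.
Proof. by move=> F G h; apply: hcoef_inj; rewrite /= addrA. Qed.
Fact haddC : commutative hadd.
Proof. by move=> F G; apply: hcoef_inj; rewrite /= addrC. Qed.
Fact sconst0 : sconst 0 = 0 :> (int -> K).
Proof. by apply/funext => i; rewrite /sconst; case: ifP. Qed.
Fact hadd0 : left_id (hconst 0) hadd.
Proof. by move=> F; apply: hcoef_inj; rewrite /= sconst0 add0r. Qed.
Fact haddN : left_inverse (hconst 0) hopp hadd.
Proof. by move=> F; apply: hcoef_inj; rewrite /= sconst0 addNr. Qed.
HB.instance Definition _ := GRing.isZmodule.Build HT haddA haddC hadd0 haddN.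

Fact hmulA : associative hmul.
Proof. by move=> F G h; apply: hcoef_inj; apply: (smulA cu); apply: hcoefP. Qed.
Fact hmulC : commutative hmul.
Proof. by move=> F G; apply: hcoef_inj; apply: (smulC cu); apply: hcoefP. Qed.
Fact hmul1 : left_id (hconst 1) hmul.
Proof.
move=> F; apply: hcoef_inj; rewrite /= (smul_const cu).
by apply/funext => i; rewrite /sscale mul1r.
Qed.
Fact hmulD : left_distributive hmul hadd.
Proof. by move=> F G h; apply: hcoef_inj; apply: (smulDl cu); apply: hcoefP. Qed.
Fact hone_neq0 : hconst 1 != hconst 0.
Proof.
apply/eqP => /(congr1 (fun F : HT => F 0)) /=.
by rewrite /sconst eqxx => /eqP; rewrite oner_eq0.
Qed.
HB.instance Definition _ := GRing.Zmodule_isComNzRing.Build HT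
  hmulA hmulC hmul1 hmulD hone_neq0.

Fact hconst_zmod : zmod_morphism hconst.
Proof.
move=> a b; apply: hcoef_inj; apply/funext => i.
change (sconst (a - b) i = sconst a i - sconst b i).
by rewrite /sconst; case: ifP => _ //; rewrite subr0.
Qed.
Fact hconst_monoid : monoid_morphism hconst.
Proof.
split=> // a b; apply: hcoef_inj; rewrite /= (smul_const cu).
by apply/funext => i; rewrite /sscale /sconst; case: ifP => // _; rewrite mulr0.
Qed.
HB.instance Definition _ := GRing.isZmodMorphism.Build K HT hconst hconst_zmod.
HB.instance Definition _ := GRing.isMonoidMorphism.Build K HT hconst hconst_monoid.

Lemma hcoefD F G : hcoef (F + G) = hcoef F + hcoef G. Proof. by []. Qed.
Lemma hcoefN F : hcoef (- F) = - hcoef F. Proof. by []. Qed.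
Lemma hcoefM F G : hcoef (F * G) = smul abs F G. Proof. by []. Qed.
Lemma hcoef1 : hcoef (1 : HT) = sone K. Proof. by []. Qed.
Lemma hcoef0 : hcoef (0 : HT) = 0. Proof. exact: sconst0. Qed.
Lemma hcoefZ a F : hcoef (hconst a * F) = sscale a F.
Proof. exact: (smul_const cu). Qed.
Lemma hcoef_sum (I : Type) (r : seq I) (P : pred I) (E : I -> HT) :
  hcoef (\sum_(i <- r | P i) E i) = \sum_(i <- r | P i) hcoef (E i).
Proof. by apply: (big_morph _ hcoefD hcoef0). Qed.
Lemma hcoefX F m : hcoef (F ^+ m) = spow abs F m.
Proof. by elim: m => [|m IH] //; rewrite exprS hcoefM IH. Qed.

End HRing.

(** * The exponential *)

Lemma expr_small (R : realType) (x e : R) :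
  0 <= x < 1 -> 0 < e -> exists N, forall n, (N <= n)%N -> x ^+ n < e.
Proof.
move=> /andP[x0 x1] e0.
(* A Bernoulli-type bound: the left side does not increase with [n], so [x ^+ n] is at most
   [1 / (1 + n (1 - x))]. *)
have bound n : x ^+ n * (1 + n%:R * (1 - x)) <= 1.
  elim: n => [|n IH]; first by rewrite expr0 mul0r addr0 mulr1.
  apply: le_trans IH; rewrite exprSr -mulrA; apply: ler_wpM2l; first exact: exprn_ge0.
  have := mulr_ge0 (ler0n R n) (sqr_ge0 (1 - x)); have := sqr_ge0 (1 - x).
  by rewrite -natr1; nra.
have d0 : 0 < 1 - x by lra.
have [N hN] : exists N : nat, e^-1 / (1 - x) < N%:R.
  exists (Num.bound (e^-1 / (1 - x))); apply: le_lt_trans (archi_boundP _).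
    by [].
  by rewrite divr_ge0 ?invr_ge0 ?ltW.
have eN : e^-1 < 1 + N%:R * (1 - x) by move: hN; rewrite ltr_pdivrMr //; lra.
exists N => n Nn; apply: (@le_lt_trans _ _ (x ^+ N)).
  by apply: ler_wiXn2l => //; exact: ltW.
have [->//|xN0] := eqVneq (x ^+ N) 0.
have xN : 0 < x ^+ N by rewrite lt_neqAle eq_sym xN0 exprn_ge0.
rewrite -[X in _ < X]mul1r -ltr_pdivrMr //.
by apply: lt_le_trans (bound N); rewrite ltr_pM2l.
Qed.

Section Exp.
Context (R : realType) (K : fieldType) (abs : K -> R) (cu : complete_ultra abs).
Let abs_ge0 := cu_ge0 cu.
Let abs_eq0 := cu_eq0 cu.
Let absM := cu_M cu.
Let absD := cu_D cu.
Let ul0 := ultra0 abs_eq0.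
Let ul1 := ultra1 abs_eq0 absM.
Let ulN := ultraN abs_ge0 abs_eq0 absM.
Let ulC := ultra_distC abs_ge0 abs_eq0 absM.
Let ulle := @ultra_le _ _ _ absD.
Local Notation HT := (Hser cu).
Local Notation hconst := (hconst cu).
Implicit Types F G E : HT.

(** The norm bound in coefficientwise form, which avoids the side conditions of [sup] and passes
    directly to limits. *)
Definition hle (F : HT) (e : R) := forall i, abs (F i) <= e.

Lemma hle_ge0 F e : hle F e -> 0 <= e.
Proof. by move=> /(_ 0); apply: le_trans. Qed.
Lemma hle_weak F d e : d <= e -> hle F d -> hle F e.
Proof. by move=> de h i; apply: le_trans (h i) de. Qed.
Lemma hleD F G e : hle F e -> hle G e -> hle (F + G) e.
Proof. by move=> hF hG i; rewrite hcoefD; apply: ulle. Qed.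
Lemma hleN F e : hle F e -> hle (- F) e.
Proof. by move=> hF i; rewrite hcoefN [(- _) i]/= ulN. Qed.
Lemma hleBC F G e : hle (F - G) e -> hle (G - F) e.
Proof. by move=> /hleN; rewrite opprB. Qed.
Lemma hle_dist G F E e : hle (F - G) e -> hle (G - E) e -> hle (F - E) e.
Proof. by move=> h1 h2; rewrite -(subrKA G); apply: hleD. Qed.
Lemma hleM F G d e : hle F d -> hle G e -> hle (F * G) (d * e).
Proof.
move=> hF hG i; apply: (smul_le cu (hcoefP F) (hcoefP G)).
  by apply: mulr_ge0; [exact: hle_ge0 hF|exact: hle_ge0 hG].
by move=> j; apply: ler_pM.
Qed.
Lemma hle_const a : hle (hconst a) (abs a).
Proof. by move=> i /=; rewrite /sconst; case: ifP => // _; rewrite ul0. Qed.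
Lemma hle0 e : 0 <= e -> hle 0 e.
Proof. by move=> e0 i; rewrite hcoef0 [0 i]/= ul0. Qed.
Lemma hle1 : hle 1 1.
Proof. by move=> i; have := hle_const 1 i; rewrite ul1. Qed.
Lemma hle_sum (I : Type) (r : seq I) (P : pred I) (E : I -> HT) e :
  0 <= e -> (forall i, P i -> hle (E i) e) -> hle (\sum_(i <- r | P i) E i) e.
Proof.
move=> e0 h; apply: (big_ind (fun F => hle F e)) => //; first exact: hle0.
by move=> F G; apply: hleD.
Qed.
Lemma hleX F e m : hle F e -> hle (F ^+ m) (e ^+ m).
Proof.
move=> h; elim: m => [|m IH]; first by rewrite !expr0; apply: hle1.
by rewrite !exprS; apply: hleM.
Qed.
Lemma hle_eq F G : (forall e, 0 < e -> hle (F - G) e) -> F = G.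
Proof.
move=> h; apply: hcoef_inj; apply/funext => i; apply: (dist_eq cu) => e e0.
exact: h.
Qed.

Lemma snorm_ge f M i : (forall j, abs (f j) <= M) -> abs (f i) <= snorm abs f.
Proof.
move=> h; apply: ub_le_sup; last by exists i.
by exists M => _ [j _ <-].
Qed.
Lemma snorm_le f M : (forall j, abs (f j) <= M) -> snorm abs f <= M.
Proof.
move=> h; apply: ge_sup; first by exists (abs (f 0)); exists 0.
by move=> _ [j _ <-].
Qed.
Lemma snorm_hle F : hle F (snorm abs F).
Proof. by move=> i; have [M _ h] := H_bounded (hcoefP F); apply: snorm_ge h. Qed.

(** Limits are taken coefficient by coefficient; since the rate is uniform in the coefficient, the
    limit inherits boundedness and decay at [+oo] from the terms. *)
Lemma hcvg_exists (u : nat -> HT) (s : R) : 0 <= s < 1 ->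
  (forall N M, (N <= M)%N -> hle (u M - u N) (s ^+ N)) ->
  exists E, forall N, hle (u N - E) (s ^+ N).
Proof.
move=> s01 h.
have cvgi i : exists l, K_cvg abs (fun N => u N i) l.
  apply: (cu_complete cu) => e e0; have [N hN] := expr_small s01 e0.
  exists N => m n Nm Nn; apply: le_lt_trans (hN N (leqnn _)).
  have hh : hle (u m - u n) (s ^+ N).
    by apply: (hle_dist (G := u N)); [|apply: hleBC]; apply: h.
  exact: hh.
have [l hl] := choice cvgi.
have dist N i : abs (l i - u N i) <= s ^+ N.
  by apply: (ultra_le_lim abs_ge0 abs_eq0 absM absD (N := N) (hl i)) => M /h /(_ i).
have Hl : H abs l.
  split.
    have [M M1 hM] := H_bounded (hcoefP (u 0%N)).
    exists M => i; rewrite -(subrK (u 0%N i) (l i)); apply: ulle => //.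
    by apply: le_trans M1; have := dist 0%N i; rewrite expr0.
  move=> e e0; have e2 : 0 < e / 2 by lra.
  have [N /(_ N (leqnn _)) hN] := expr_small s01 e2.
  have [N0 hN0] := H_small (hcoefP (u N)) e2; exists N0%:Z => i /hN0 hi.
  apply: (@le_lt_trans _ _ (e / 2)); last lra.
  rewrite -(subrK (u N i) (l i)); apply: ulle => //.
  by apply: le_trans (dist N i) _; apply: ltW.
exists (HSer cu Hl) => N i; rewrite hcoefD hcoefN; have := dist N i.
by rewrite ulC.
Qed.

Lemma H_cvg_hle (u : nat -> HT) E (s : R) : 0 <= s < 1 ->
  (forall N, hle (u N - E) (s ^+ N)) -> H_cvg abs (fun N => hcoef (u N)) E.
Proof.
move=> s01 h; split; [by move=> n; apply: hcoefP|exact: hcoefP|move=> e e0].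
have [N hN] := expr_small s01 e0; exists N => n /hN; apply: le_lt_trans.
exact: (snorm_le (h n)).
Qed.

Definition expT F m : HT := hconst (m`!%:R)^-1 * F ^+ m.
Definition expN F N : HT := \sum_(m < N) expT F m.

Section Domain.
Variable s : R.
Hypothesis s01 : 0 <= s < 1.
Hypothesis fact_neq0 : forall m, (m`!)%:R != 0 :> K.

Let s0 : 0 <= s. Proof. by case/andP: s01. Qed.
Let s1 : s <= 1. Proof. by case/andP: s01 => _ /ltW. Qed.

Definition exp_dom F := forall m, hle (expT F m) (s ^+ m).
(** The explicit rate, shared by all exponentials in play, replaces an epsilon-style limit: errors
    of products are then again bounded by [s ^+ N]. *)
Definition is_exp F E := forall N, hle (expN F N - E) (s ^+ N).

Lemma s_le m n : (m <= n)%N -> s ^+ n <= s ^+ m.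
Proof. by move=> mn; apply: ler_wiXn2l. Qed.

Lemma expN_hle1 F N : exp_dom F -> hle (expN F N) 1.
Proof.
move=> dF; apply: hle_sum => // m _; apply: hle_weak (dF m).
exact: exprn_ile1.
Qed.

Lemma is_exp_exists F : exp_dom F -> exists E, is_exp F E.
Proof.
move=> dF; apply: hcvg_exists => // N M NM.
rewrite /expN -!(big_mkord xpredT (expT F)) (@big_cat_nat _ _ _ N 0 M) //= addrAC subrr add0r.
rewrite big_seq_cond; apply: hle_sum; first exact: exprn_ge0.
move=> m; rewrite mem_index_iota => /andP[/andP[Nm _] _].
exact: hle_weak (s_le Nm) (dF m).
Qed.

Lemma is_exp_unique F E E' : is_exp F E -> is_exp F E' -> E = E'.
Proof.
move=> h h'; apply: hle_eq => e e0.
have [N /(_ N (leqnn _)) /ltW hN] := expr_small s01 e0.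
apply: hle_weak hN _; apply: (hle_dist (G := expN F N)) => //.
exact: hleBC.
Qed.

Lemma is_exp_hle1 F E : exp_dom F -> is_exp F E -> hle E 1.
Proof.
move=> dF h; rewrite -[E](subrK (expN F 0)); apply: hleD; last exact: expN_hle1.
by apply: hleBC; have := h 0%N; rewrite expr0.
Qed.

Lemma is_exp0 : is_exp 0 1.
Proof.
(* The empty partial sum misses the limit 1 by 1, which [s ^+ 0] just allows. *)
case=> [|N]; first by rewrite /expN big_ord0 sub0r; apply: hleN; apply: hle1.
rewrite /expN big_ord_recl /= {1}/expT fact0 invr1 rmorph1 mul1r expr0.
rewrite big1 ?addr0 ?subrr; first by apply: hle0; apply: exprn_ge0.
by move=> i _; rewrite /expT expr0n /= mulr0.
Qed.

(** The binomial theorem divided by [m!]; [fact_neq0] makes the inverse factorials cancel in [K]. *)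
Lemma expT_add F G m : expT (F + G) m = \sum_(i < m.+1) expT F (m - i) * expT G i.
Proof.
rewrite /expT exprDn mulr_sumr; apply: eq_bigr => i _.
have im : (i <= m)%N by rewrite -ltnS.
rewrite mulrnAr -mulrnAl [RHS]mulrACA -rmorphM -rmorphMn; congr (hconst _ * _).
rewrite -mulr_natr -(bin_fact im) -invfM -natrM [(i`! * _)%N]mulnC mulnC.
rewrite natrM invfM -mulrA mulVf ?mulr1 //.
have := fact_neq0 m; rewrite -(bin_fact im) natrM mulf_eq0 negb_or.
by case/andP.
Qed.

Lemma expN_add F G N : expN (F + G) N =
  \sum_(a < N) \sum_(b < N | (a + b < N)%N) expT F a * expT G b.
Proof.
rewrite /expN [RHS](exchange_big_dep xpredT) //=.
transitivity (\sum_(m < N) \sum_(i < N | (i <= m)%N) expT F (m - i) * expT G i).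
  apply: eq_bigr => m _; rewrite expT_add.
  rewrite (big_ord_widen_cond N xpredT (fun i => expT F (m - i) * expT G i)) //.
rewrite (exchange_big_dep xpredT) //=; apply: eq_bigr => i _.
rewrite -(big_mkord (fun m => (i <= m)%N) (fun m => expT F (m - i) * expT G i)).
rewrite -(big_mkord (fun m => (m + i < N)%N) (fun m => expT F m * expT G i)).
have iN := ltnW (ltn_ord i).
rewrite (@big_cat_nat _ _ _ i 0 N) //= big_nat_cond big_pred0 ?add0r; last by move=> m; lia.
rewrite [RHS](@big_cat_nat _ _ _ (N - i) 0 N) ?leq_subr //=.
rewrite [X in _ = _ + X]big_nat_cond [X in _ = _ + X]big_pred0 ?addr0; last by move=> m; lia.
rewrite -{1}[nat_of_ord i]add0n big_addn.
rewrite big_nat_cond [RHS]big_nat_cond; apply: eq_big => [m|m _]; first by lia.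
by rewrite addnK.
Qed.

(** The product of partial sums runs over a square, the partial sum for [F + G] over the triangle
    [a + b < N]. What is left has terms of norm at most [s ^+ (a + b) <= s ^+ N]. *)
Lemma is_exp_add F G E E' : exp_dom F -> exp_dom G ->
  is_exp F E -> is_exp G E' -> is_exp (F + G) (E * E').
Proof.
move=> dF dG hE hE' N.
apply: (hle_dist (G := expN F N * expN G N)).
  rewrite expN_add /expN mulr_suml -sumrB.
  apply: hle_sum => [|a _]; first exact: exprn_ge0.
  rewrite mulr_sumr [X in _ - X](bigID (fun b : 'I_N => (a + b < N)%N)) /=.
  rewrite opprD addrA subrr sub0r; apply/hleN/hle_sum => [|b]; first exact: exprn_ge0.
  rewrite -leqNgt => /s_le Nab; apply: hle_weak Nab _; rewrite exprD.
  exact: hleM.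
apply: (hle_dist (G := E * expN G N)).
  rewrite -mulrBl -[s ^+ N]mulr1; apply: hleM; [exact: hE|exact: expN_hle1].
rewrite -mulrBr -[s ^+ N]mul1r; apply: hleM; [exact: is_exp_hle1 hE|exact: hE'].
Qed.

Lemma is_exp_opp F E E' : exp_dom F -> exp_dom (- F) ->
  is_exp F E -> is_exp (- F) E' -> E * E' = 1.
Proof.
move=> dF dF' hE hE'; apply: (@is_exp_unique 0); last exact: is_exp0.
by rewrite -(subrr F); apply: is_exp_add.
Qed.

Lemma is_exp_H F E : is_exp F E -> H_has_exp abs F E.
Proof.
move=> h; rewrite /H_has_exp /H_has_sum.
have -> : (fun N => \sum_(k < N) sscale ((k`!)%:R)^-1 (spow abs F k)) =
          (fun N => hcoef (expN F N)).
  apply/funext => N; rewrite hcoef_sum; apply: eq_bigr => k _.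
  by rewrite hcoefZ hcoefX.
exact: H_cvg_hle s01 h.
Qed.

End Domain.
End Exp.

(** * Completeness of finite extensions of the p-adic field *)

Section PadicIntAbs.
Context (R : realType) (p : nat) (p_pr : prime p).
Local Notation Zp := (padic_int p_pr).
Implicit Types x y z : Zp.
Local Notation iabs := (@padic_int_abs R p p_pr).

Let p0 : (0 < p)%N := prime_gt0 p_pr.
Let pR0 : 0 < p%:R :> R. Proof. by rewrite ltr0n. Qed.
Let pR1 : 1 < p%:R :> R. Proof. by rewrite ltr1n prime_gt1. Qed.

Lemma residue0 x : x 0%N = 0%N.
Proof. by rewrite -residue_mod expn0 modn1. Qed.

Lemma residue_le x m n : (m <= n)%N -> (x n %% p ^ m)%N = x m.
Proof. by move=> mn; rewrite -{1}(subnK mn) residue_modD residue_mod. Qed.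

Lemma residue_eq0_le x m n : (m <= n)%N -> x n = 0%N -> x m = 0%N.
Proof. by move=> mn xn; rewrite -(residue_le x mn) xn mod0n. Qed.

Lemma residueM x y n : (x * y) n = ((x n * y n) %% p ^ n)%N.
Proof. by []. Qed.

Lemma residueD x y n : (x + y) n = ((x n + y n) %% p ^ n)%N.
Proof. by []. Qed.

Lemma residue_nat k n : (k%:R : Zp) n = (k %% p ^ n)%N.
Proof.
elim: k => [|k IH]; first by [].
by rewrite -natr1 residueD IH -addn1 -[RHS]modnDm.
Qed.

Lemma residueB_eq0 x y n : (x - y) n = 0%N <-> x n = y n.
Proof.
split=> [h|h].
  by rewrite -[x](subrK y) residueD h add0n residue_mod.
change (((x n + (p ^ n - y n) %% p ^ n) %% p ^ n)%N = 0%N).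
rewrite h modnDmr subnKC ?modnn //.
by rewrite -residue_mod ltnW // ltn_mod expn_gt0 p0.
Qed.

Let padic_int_abs_lb x : has_lbound [set (p%:R ^- n : R) | n in [set n | x n = 0%N]].
Proof. by exists (0 : R) => _ [n _ <-]; rewrite invr_ge0 exprn_ge0 // ltW. Qed.

Lemma padic_int_abs_le x m : x m = 0%N -> iabs x <= p%:R ^- m.
Proof. by move=> xm; apply: ge_inf; [exact: padic_int_abs_lb|exists m]. Qed.

Lemma pXV_le m n : (m <= n)%N -> p%:R ^- n <= p%:R ^- m :> R.
Proof.
by move=> mn; rewrite lef_pV2 ?posrE ?exprn_gt0 // ler_weXn2l // ltW.
Qed.

Lemma padic_int_abs_ge x v : x v.+1 <> 0%N -> p%:R ^- v <= iabs x.
Proof.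
move=> xv; apply: lb_le_inf; first by exists 1, 0%N; rewrite ?expr0 ?invr1 //= residue0.
move=> _ [n /= xn <-]; apply: pXV_le; rewrite leqNgt; apply/negP => vn.
exact/xv/(residue_eq0_le vn).
Qed.

Lemma padic_int_abs_residue x m : iabs x <= p%:R ^- m -> x m = 0%N.
Proof.
case: m => [|m] h; first exact: residue0.
apply: contrapT => /padic_int_abs_ge h'; have := le_trans h' h.
rewrite lef_pV2 ?posrE ?exprn_gt0 // exprS.
by rewrite ger_pMl ?exprn_gt0 // => h1; have := lt_le_trans pR1 h1; rewrite ltxx.
Qed.

Lemma padic_int_abs0 : iabs 0 = 0.
Proof.
apply/eqP; rewrite eq_le; apply/andP; split; last first.
  apply: lb_le_inf; first by exists 1, 0%N; rewrite ?expr0 ?invr1.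
  by move=> _ [n _ <-]; rewrite invr_ge0 exprn_ge0 // ltW.
rewrite leNgt; apply/negP => h.
have [|N /(_ N (leqnn _))] := @expr_small R (p%:R^-1) _ _ h.
  by rewrite invr_ge0 ltW //= invf_lt1.
rewrite exprVn => hN; have := le_lt_trans (@padic_int_abs_le 0 N (mod0n _)) hN.
by rewrite ltxx.
Qed.

(** The integer [v] is the p-adic valuation; vanishing residues form an initial segment, so the pair
    of conditions pins it down. *)
Lemma padic_val x : x != 0 -> exists v, x v = 0%N /\ x v.+1 <> 0%N.
Proof.
move=> /padic_neq0 ex; case: (ex_minnP ex) => [[|v]]; first by rewrite expn0 dvd1n.
move=> xv min; exists v; split.
  have : (p ^ v %| x v)%N by apply: contraT => /min; rewrite ltnn.
  by rewrite /dvdn residue_mod => /eqP.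
by move=> h; rewrite h dvdn0 in xv.
Qed.

Lemma padic_int_abs_val x v : x v = 0%N -> x v.+1 <> 0%N -> iabs x = p%:R ^- v.
Proof. by move=> h h'; apply/eqP; rewrite eq_le padic_int_abs_le // padic_int_abs_ge. Qed.

(** Any level beyond [v] already sees the exact valuation, which makes the arithmetic of [logn] on
    natural numbers available. *)
Lemma logn_residue x v n : (v < n)%N -> x v = 0%N -> x v.+1 <> 0%N ->
  (0 < x n)%N /\ logn p (x n) = v.
Proof.
move=> vn xv xv1.
have d1 : (p ^ v %| x n)%N by rewrite /dvdn (residue_le x (ltnW vn)) xv.
have d2 : ~~ (p ^ v.+1 %| x n)%N by rewrite /dvdn (residue_le x vn); apply/eqP.
have xn : (0 < x n)%N by case: (x n) d2 => //; rewrite dvdn0.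
split=> //; apply/eqP; rewrite eqn_leq.
by move: d1 d2; rewrite !pfactor_dvdn // -ltnNge ltnS => -> ->.
Qed.

Lemma padic_int_absM x y : iabs (x * y) = iabs x * iabs y.
Proof.
have [->|x0] := eqVneq x 0; first by rewrite mul0r padic_int_abs0 mul0r.
have [->|y0] := eqVneq y 0; first by rewrite mulr0 padic_int_abs0 mulr0.
have [v [xv xv1]] := padic_val x0; have [w [yw yw1]] := padic_val y0.
rewrite (padic_int_abs_val xv xv1) (padic_int_abs_val yw yw1) -invfM -exprD; apply: padic_int_abs_val.
  rewrite residueM; apply/eqP; rewrite -/(dvdn _ _) expnD dvdn_mul //.
    by rewrite /dvdn residue_le ?leq_addr ?xv.
  by rewrite /dvdn residue_le ?leq_addl ?yw.
rewrite residueM => /eqP; rewrite -/(dvdn _ _).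
have [xn lx] := @logn_residue x v (v + w).+1 (leq_addr _ _) xv xv1.
have [yn ly] := @logn_residue y w (v + w).+1 (leq_addl _ _ : w < (v + w).+1)%N yw yw1.
by rewrite pfactor_dvdn ?muln_gt0 ?xn // lognM // lx ly ltnn.
Qed.

Lemma padic_int_abs_gt0 x : x != 0 -> 0 < iabs x.
Proof. by move=> /padic_val[v [? ?]]; rewrite (@padic_int_abs_val _ v) // invr_gt0 exprn_gt0. Qed.

Lemma padic_numden (a : padic p_pr) :
  a * FracField.tofrac (repr a).2 = FracField.tofrac (repr a).1.
Proof.
have d0 := denom_ratioP (repr a).
rewrite -{1}[a]reprK; unlock FracField.tofrac; rewrite -[LHS]FracField.pi_mul.
apply/eqP; rewrite FracField.equivf_def /FracField.mulf /=.
by rewrite !numden_Ratio ?oner_eq0 ?mulr1 ?oner_neq0 // mulrC.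
Qed.

(** The representative chosen for the fraction need not be [x / 1]; cross-multiplication and
    multiplicativity of [iabs] remove the choice. *)
Lemma padic_abs_tofrac x : padic_abs R (FracField.tofrac x) = iabs x.
Proof.
have := padic_numden (FracField.tofrac x).
rewrite -rmorphM /= => /eqP; rewrite tofrac_eq => /eqP e.
rewrite /padic_abs -e padic_int_absM mulfK // gt_eqF // padic_int_abs_gt0 //.
exact: denom_ratioP.
Qed.

Lemma padic_abs_p : padic_abs R (p%:R : padic p_pr) = p%:R^-1.
Proof.
rewrite -(rmorph_nat (@FracField.tofrac Zp)) /= padic_abs_tofrac.
have p1 := prime_gt1 p_pr.
rewrite (@padic_int_abs_val _ 1) ?expr1 // residue_nat ?expn1 ?modnn //.
by rewrite modn_small; [apply/eqP; rewrite -lt0n|rewrite -[X in (X < _)%N]expn1 ltn_exp2l].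
Qed.

End PadicIntAbs.

(** * Completeness of Q_p *)

Section PadicComplete.
Context (R : realType) (p : nat) (p_pr : prime p).
Local Notation Zp := (padic_int p_pr).
Local Notation Qp := (padic p_pr).
Local Notation N := (@padic_abs R p p_pr).
Local Notation tofrac := (@FracField.tofrac Zp).
Hypothesis N_ge0 : forall x, 0 <= N x.
Hypothesis N_eq0 : forall x, N x = 0 <-> x = 0.
Hypothesis NM : forall x y, N (x * y) = N x * N y.
Hypothesis ND : forall x y, N (x + y) <= Num.max (N x) (N y).

Let p0 : (0 < p)%N := prime_gt0 p_pr.
Let pR0 : 0 < p%:R :> R. Proof. by rewrite ltr0n. Qed.
Let pR1 : 1 < p%:R :> R. Proof. by rewrite ltr1n prime_gt1. Qed.
Let q01 : 0 <= (p%:R^-1 : R) < 1.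
Proof. by rewrite invr_ge0 ltW //= invf_lt1. Qed.

(** Write [a = x / d] with [v] the valuation of [d]; then [p^v] divides [x] as well. A Bezout
    relation inverts [d] modulo [p^M] up to the factor [p^v], giving [k] with [k d = x] modulo
    [p^M]; dividing by [d] costs only [p^v]. *)
Lemma nat_dense (a : Qp) m : N a <= 1 ->
  exists k : nat, N (a - k%:R) <= p%:R ^- m.
Proof.
move=> a1; set d := (repr a).2; set x := (repr a).1.
have adx : a * tofrac d = tofrac x := padic_numden a.
have d0 : d != 0 := denom_ratioP (repr a).
have [v [dv dv1]] := padic_val d0.
have xd : padic_int_abs R x <= padic_int_abs R d.
  by rewrite -!padic_abs_tofrac -adx NM ler_piMl.
have xv : x v = 0%N by apply: (@padic_int_abs_residue R); rewrite -(padic_int_abs_val R dv dv1).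
(* The extra 1 ensures [v < M] even for [m = 0], so that level [M] determines the valuation of
   [d]. *)
pose M := (m.+1 + v)%N.
have vM : (v < M)%N by rewrite /M addSn ltnS leq_addl.
have [dM ldM] := logn_residue vM dv dv1.
have g : gcdn (d M) (p ^ M) = (p ^ v)%N.
  have /(dvdn_pfactor _ _ p_pr) [e eM ge] := dvdn_gcdr (d M) (p ^ M).
  rewrite ge; congr (p ^ _)%N; apply/eqP; rewrite eqn_leq; apply/andP; split.
    by have := dvdn_gcdl (d M) (p ^ M); rewrite ge pfactor_dvdn // ldM.
  have : (p ^ v %| gcdn (d M) (p ^ M))%N.
    by rewrite dvdn_gcd pfactor_dvdn // ldM leqnn dvdn_exp2l // ltnW.
  by rewrite ge dvdn_Pexp2l // prime_gt1.
have [km kn e _] := egcdnP (p ^ M) dM.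
have [t xt] : exists t, x M = (t * p ^ v)%N.
  by apply/dvdnP; rewrite /dvdn residue_le ?xv // ltnW.
pose k := (t * km)%N; exists k.
pose z : Zp := x - k%:R * d.
have zM : z M = 0%N.
  apply/residueB_eq0; rewrite residueM residue_nat modnMml /k -mulnA e mulnDr g -xt.
  by rewrite mulnA modnMDl residue_mod.
have az : (a - k%:R) * tofrac d = tofrac z.
  by rewrite mulrBl adx /z tofracB tofracM; congr (_ - _ * _); rewrite (rmorph_nat tofrac).
have hz : N (a - k%:R) * padic_int_abs R d = padic_int_abs R z.
  by rewrite -!padic_abs_tofrac -NM az.
rewrite -(ler_pM2r (padic_int_abs_gt0 R d0)) hz; apply: le_trans (padic_int_abs_le R zM) _.
rewrite (padic_int_abs_val R dv dv1) -invfM -exprD; apply: (pXV_le R p_pr).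
by rewrite leq_add2r.
Qed.

(** After scaling into the unit ball, natural numbers [y m] approximate a subsequence to within
    [p^-m]. The Cauchy property makes them coherent modulo powers of [p], hence an element of the
    inverse limit Z_p. *)
Lemma padic_complete (u : nat -> Qp) : K_cauchy N u -> exists l, K_cvg N u l.
Proof.
have Np : N p%:R = p%:R^-1 := padic_abs_p R p_pr.
have p_neq0 : p%:R != 0 :> Qp.
  by apply/eqP => /N_eq0; rewrite Np => /eqP; rewrite invr_eq0 gt_eqF.
have uldist := @ultra_dist _ _ _ ND.
have ulC := ultra_distC N_ge0 N_eq0 NM.
move=> cu; have [N0 hN0] := cu 1 ltr01.
pose B := N (u N0) + 1.
have B0 : 0 < B by have := N_ge0 (u N0); rewrite /B; lra.
have Bi : 0 < B^-1 by rewrite invr_gt0.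
(* [B] bounds the sequence from [N0] on, so multiplying by [p^j] brings that tail into the unit
   ball. *)
have [j /(_ j (leqnn _)) hj] := expr_small q01 Bi.
pose w n := u (n + N0)%N * p%:R ^+ j.
have w1 n : N (w n) <= 1.
  rewrite NM (ultraX N_eq0 NM) Np -[X in _ <= X](mulfV (lt0r_neq0 B0)).
  apply: ler_pM; [exact: N_ge0|by apply: exprn_ge0; case/andP: q01| |exact: ltW].
  rewrite -(subrK (u N0) (u _)); apply: (ultra_le ND); rewrite /B; last lra.
  by have := N_ge0 (u N0); have := hN0 (n + N0)%N N0 (leq_addl _ _) (leqnn _); lra.
have qX m : 0 < p%:R ^- m :> R by rewrite invr_gt0 exprn_gt0.
have cw m : exists L, forall i k, (L <= i)%N -> (L <= k)%N -> N (w i - w k) <= p%:R ^- m.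
  have [L hL] := cu _ (qX m); exists L => i k Li Lk.
  rewrite -mulrBl NM (ultraX N_eq0 NM) Np -[X in _ <= X]mulr1.
  apply: ler_pM; [exact: N_ge0|by apply: exprn_ge0; case/andP: q01| |].
    by apply/ltW/hL; rewrite (leq_trans _ (leq_addr _ _)).
  by apply: exprn_ile1; [rewrite invr_ge0 ltW|apply/ltW; rewrite invf_lt1].
have [phi hphi] := choice cw.
have [y hy] := choice (fun m => nat_dense m (w1 (phi m))).
have yP m : (y m.+1 = y m %[mod p ^ m])%N.
  rewrite -!(residue_nat p_pr) -residueB_eq0; apply: (@padic_int_abs_residue R).
  rewrite -padic_abs_tofrac rmorphB !rmorph_nat.
  have pm : p%:R ^- m.+1 <= p%:R ^- m :> R by apply: (pXV_le R p_pr).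
  apply: (@uldist (w (phi m.+1))); first by rewrite ulC; apply: le_trans pm.
  apply: (@uldist (w (maxn (phi m) (phi m.+1)))).
    by apply: le_trans pm; apply: hphi => //; apply: leq_maxr.
  apply: (@uldist (w (phi m))) => //.
  by apply: hphi => //; apply: leq_maxl.
pose l : Zp := of_residues p_pr yP.
have lw m n : (phi m <= n)%N -> N (w n - tofrac l) <= p%:R ^- m.
  move=> mn; apply: (@uldist (w (phi m))); first exact: hphi.
  apply: uldist (hy m) _; rewrite -(rmorph_nat tofrac) -rmorphB /= padic_abs_tofrac.
  by apply: padic_int_abs_le; apply/residueB_eq0; rewrite residue_nat.
exists (tofrac l / p%:R ^+ j) => e e0.
have ej : 0 < e * N (p%:R ^+ j).
  by rewrite mulr_gt0 // (ultra_gt0 N_ge0 N_eq0) expf_neq0.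
have [m /(_ m (leqnn _)) hm] := expr_small q01 ej.
exists (phi m + N0)%N => n hn.
have pj0 : p%:R ^+ j != 0 :> Qp by rewrite expf_neq0.
have pj : 0 < N (p%:R ^+ j) by rewrite (ultra_gt0 N_ge0 N_eq0).
rewrite -(ltr_pM2r pj) -NM mulrBl divfK //.
apply: le_lt_trans hm; rewrite exprVn.
have N0n : (N0 <= n)%N by apply: leq_trans hn; apply: leq_addl.
have := lw m (n - N0)%N; rewrite /w subnK //; apply.
by rewrite leq_subRL // addnC.
Qed.

End PadicComplete.

Section ExtComplete.
Context (R : realType) (p : nat) (p_pr : prime p) (K : fieldExtType (padic p_pr)).
Context (abs : K -> R) (abs_padic : is_padic_abs abs).
Let age0 := abs_ge0 abs_padic.
Let aeq0 := abs_eq0 abs_padic.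
Let aM := absM abs_padic.
Let aD := abs_ultra abs_padic.
Let aE := abs_extends abs_padic.
Local Notation N := (@padic_abs R p p_pr).

(** The axioms needed on Q_p are pulled back from [abs] along [a |-> a%:A]. *)
Lemma padic_abs_complete (u : nat -> padic p_pr) :
  K_cauchy N u -> exists l, K_cvg N u l.
Proof.
apply: padic_complete => [x|x|x y|x y]; rewrite -!aE //.
- split; first by move=> /aeq0 /eqP; rewrite scaler_eq0 oner_eq0 orbF => /eqP.
  by move=> ->; rewrite scale0r; apply/aeq0.
- by rewrite -aM -scalerAl mul1r scalerA.
- by rewrite scalerDl.
Qed.

Lemma absZ a x : abs (a *: x) = N a * abs x.
Proof. by rewrite -aE -aM -scalerAl mul1r. Qed.

(* If [e] is outside the complete subspace spanned by [s], its distance to that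
   subspace is positive, so the coordinates along [e] of a Cauchy sequence form a
   Cauchy sequence. *)
Lemma span_complete (s : seq K) (u : nat -> K) :
  (forall n, u n \in <<s>>%VS) -> K_cauchy abs u ->
  exists2 l, l \in <<s>>%VS & K_cvg abs u l.
Proof.
have ulC := ultra_distC age0 aeq0 aM.
elim: s u => [|e s IH] u us cu.
  exists 0; first exact: mem0v.
  move=> d d0; exists 0%N => n _; have := us n.
  by rewrite span_nil memv0 => /eqP ->; rewrite subrr (ultra0 aeq0).
have [es|es] := boolP (e \in <<s>>%VS).
  have ss : <<e :: s>>%VS = <<s>>%VS.
    by rewrite span_cons; apply/addv_idPr; rewrite -memvE.
  by rewrite ss; apply: IH => // n; rewrite -ss.
have [d d0 hd] : exists2 d, 0 < d & forall w, w \in <<s>>%VS -> d <= abs (e - w).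
  (* Otherwise points of the span within [2^-n] of [e] form a Cauchy sequence; the induction
     hypothesis gives it a limit in the span, which must be [e]. *)
  apply: contrapT => hN.
  have ex n : exists2 w, w \in <<s>>%VS & abs (e - w) < 2^-1 ^+ n.
    apply: contrapT => hn; apply: hN; exists (2^-1 ^+ n).
      by rewrite exprn_gt0 // invr_gt0.
    by move=> w ws; rewrite leNgt; apply/negP => h; apply: hn; exists w.
  have [w hw] := choice (fun n => let: ex_intro2 w a b := ex n in
    ex_intro (fun w => w \in <<s>>%VS /\ abs (e - w) < 2^-1 ^+ n) w (conj a b)).
  have wc : K_cvg abs w e.
    move=> d d0; have [|L hL] := @expr_small R 2^-1 d _ d0; first lra.
    by exists L => n Ln; rewrite ulC; apply: lt_trans (hL n Ln); case: (hw n).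
  have [|l ls wl] := IH w _ (K_cvg_cauchy age0 aeq0 aM aD wc).
    by move=> n; case: (hw n).
  by move: es; rewrite (K_cvg_unique age0 aeq0 aM aD wc wl) ls.
have dec n : exists ww : padic p_pr * K, ww.2 \in <<s>>%VS /\ u n = ww.1 *: e + ww.2.
  have := us n; rewrite span_cons => /memv_addP[_ /vlineP[a ->] [w ws ->]].
  by exists (a, w).
have [aw haw] := choice dec.
have wlow a w : w \in <<s>>%VS -> N a * d <= abs (a *: e + w).
  move=> ws; have [->|a0] := eqVneq a 0.
    by rewrite -aE scale0r (ultra0 aeq0) mul0r.
  have -> : a *: e + w = a *: (e - - (a^-1 *: w)).
    by rewrite opprK scalerDr scalerA divff // scale1r.
  rewrite absZ; apply: ler_wpM2l; first by rewrite -aE.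
  by apply: hd; rewrite rpredN rpredZ.
pose a n := (aw n).1; pose w n := (aw n).2.
have uE n : u n = a n *: e + w n by case: (haw n).
have ws n : w n \in <<s>>%VS by case: (haw n).
have ca : K_cauchy N a.
  move=> r r0; have [L hL] := cu _ (mulr_gt0 r0 d0); exists L => m n Lm Ln.
  rewrite -(ltr_pM2r d0); apply: le_lt_trans (hL m n Lm Ln).
  have -> : u m - u n = (a m - a n) *: e + (w m - w n).
    by rewrite !uE scalerBl opprD addrACA.
  by apply: wlow; rewrite rpredB.
have [l hl] := padic_abs_complete ca.
have e1 : 0 < abs e + 1 by have := age0 e; lra.
have cal : K_cvg abs (fun n => a n *: e) (l *: e).
  move=> r r0; have [L hL] := hl _ (divr_gt0 r0 e1); exists L => n /hL h.
  rewrite -scalerBl absZ; apply: (@le_lt_trans _ _ (N (a n - l) * (abs e + 1))).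
    by apply: ler_wpM2l; [rewrite -aE|lra].
  by rewrite -ltr_pdivlMr.
have cae := K_cvg_cauchy age0 aeq0 aM aD cal.
have cw : K_cauchy abs w.
  move=> r r0; have [L hL] := cu _ r0; have [L' hL'] := cae _ r0.
  exists (maxn L L') => m n; rewrite !geq_max => /andP[m1 m2] /andP[n1 n2].
  have -> : w m - w n = (u m - u n) + - (a m *: e - a n *: e).
    by rewrite !uE; ring.
  by apply: (ultra_lt aD); rewrite ?(ultraN age0 aeq0 aM); [apply: hL|apply: hL'].
have [l' l's hl'] := IH w ws cw.
exists (l *: e + l').
  by rewrite span_cons memv_add // rpredZ // memv_line.
move=> r r0; have [L hL] := cal _ r0; have [L' hL'] := hl' _ r0.
exists (maxn L L') => n; rewrite geq_max => /andP[/hL h1 /hL' h2].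
have -> : u n - (l *: e + l') = (a n *: e - l *: e) + (w n - l') by rewrite uE; ring.
exact: (ultra_lt aD).
Qed.

Lemma padic_complete_ultra : complete_ultra abs.
Proof.
split=> // u cu.
have [|l _ hl] := @span_complete (vbasis {:K}) u _ cu; last by exists l.
by move=> n; rewrite (span_basis (vbasisP _)) memvf.
Qed.

Lemma padic_abs_p_ext : abs p%:R = p%:R^-1.
Proof.
rewrite -(padic_abs_p R p_pr) -aE; congr abs.
by rewrite scaler_nat.
Qed.

End ExtComplete.

(** * The groups Gamma and the theorem *)

(** With [max(i, 0)] as exponent, [|F i| <= rho ^+ pospart i] covers both the norm bound ([i <= 0])
    and the decay ([i > 0]) in [Gamma_], including [rho = 0] since [0 ^+ 0 = 1]. *)
Definition pospart (i : int) : nat := if i is Posz n then n else 0%N.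

Lemma pospartP (i : int) :
  (0 <= i /\ i = pospart i :> int) \/ (i < 0 /\ pospart i = 0%N).
Proof. by case: i => i; [left|right]. Qed.

Lemma pospart_sub (n i : int) : (pospart n <= pospart i + pospart (n - i))%N.
Proof. by have := pospartP n; have := pospartP i; have := pospartP (n - i); lia. Qed.

Lemma pospart_opp (i : int) : i != 0 -> (0 < pospart i + pospart (0 - i))%N.
Proof. by have := pospartP i; have := pospartP (0 - i); lia. Qed.

Section Gamma.
Context (R : realType) (K : fieldType) (abs : K -> R) (cu : complete_ultra abs).
Let age0 := cu_ge0 cu.
Let aeq0 := cu_eq0 cu.
Let aM := cu_M cu.
Let aD := cu_D cu.
Let ul0 := ultra0 aeq0.
Let ul1 := ultra1 aeq0 aM.
Let ulC := ultra_distC age0 aeq0 aM.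
Local Notation HT := (Hser cu).
Local Notation hconst := (hconst cu).
Implicit Types F G E : HT.

Lemma Gamma_P (rho : R) F : 0 <= rho <= 1 ->
  Gamma_ abs rho F <->
  abs (F 0) = 1 /\ forall i, abs (F i) <= rho ^+ pospart i.
Proof.
move=> /andP[r0 r1]; split=> [[_ _ n1 h0 h]|[h0 h]].
  split=> // -[[|i]|i]; first by rewrite h0 expr0.
    by have := h (Posz i.+1) isT; rewrite -exprnP.
  by rewrite expr0 -n1; apply: snorm_hle.
have le1 i : abs (F i) <= 1 by apply: le_trans (h i) _; apply: exprn_ile1.
split=> //; first exact: hcoefP.
- by move=> F0; move: h0; rewrite F0 [0 0]/= ul0 => /eqP; rewrite eq_sym oner_eq0.
- apply/eqP; rewrite eq_le (snorm_le le1) -h0; exact: snorm_hle.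
- by case=> // i _; rewrite -exprnP; apply: (h (Posz i)).
Qed.

(** Subadditivity of [pospart] gives the decay. In coefficient 0 every term but [F 0 * G 0] has a
    positive exponent, hence size at most [rho < 1], and the isosceles principle applies. *)
Lemma Gamma_mul (rho : R) F G : 0 <= rho < 1 ->
  Gamma_ abs rho F -> Gamma_ abs rho G -> Gamma_ abs rho (F * G : HT).
Proof.
move=> /andP[r0 r1]; have r01 : 0 <= rho <= 1 by rewrite r0 ltW.
move=> /(Gamma_P _ r01)[F0 Fi] /(Gamma_P _ r01)[G0 Gi]; apply/(Gamma_P _ r01).
have prod n i : abs (F i) * abs (G (n - i)) <= rho ^+ (pospart i + pospart (n - i)).
  by rewrite exprD; apply: ler_pM.
split; last first.
  move=> n; apply: (smul_le cu (hcoefP F) (hcoefP G)); first exact: exprn_ge0.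
  move=> i; apply: le_trans (prod n i) _; apply: ler_wiXn2l => //; first exact: ltW.
  exact: pospart_sub.
have d1 : abs ((F * G : HT) 0 - F 0 * G 0) <= rho.
  rewrite hcoefM /smul.
  have -> : F 0 * G 0 = \sum_(i <- [:: 0 : int]) F i * G (0 - i) by rewrite big_seq1.
  apply: (zsum_approx cu) => //; first exact: (conv_null cu _ (hcoefP F) (hcoefP G)).
  move=> i; rewrite inE => i0; rewrite aM; apply: le_trans (prod 0 i) _.
  rewrite -[X in _ <= X]expr1; apply: ler_wiXn2l => //; first exact: ltW.
  exact: pospart_opp.
have FG1 : abs (F 0 * G 0) = 1 by rewrite aM F0 G0 mulr1.
rewrite -[RHS]FG1; apply: (ultra_eq age0 aeq0 aM aD).
by rewrite ulC FG1; apply: le_lt_trans r1.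
Qed.

Lemma Gamma_weak (rho rho' : R) F : 0 <= rho -> rho <= rho' <= 1 ->
  Gamma_ abs rho F -> Gamma_ abs rho' F.
Proof.
move=> r0 /andP[rr r1] /Gamma_P h; have [|F0 Fi] := h; first by rewrite r0 (le_trans rr).
apply/Gamma_P; first by rewrite r1 (le_trans r0).
split=> // i; apply: le_trans (Fi i) _; exact: lerXn2r (le_trans r0 rr) rr.
Qed.

Lemma Gamma_mulr F G : Gamma abs F -> Gamma abs G -> Gamma abs (F * G : HT).
Proof.
move=> [r /andP[r0 r1] GF] [r' /andP[r0' r1'] GG].
exists (Num.max r r'); first by rewrite /= le_max r0 gt_max r1.
apply: Gamma_mul; first by rewrite le_max r0 gt_max r1.
  by apply: (Gamma_weak r0 _ GF); rewrite le_max lexx ge_max (ltW r1) (ltW r1').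
by apply: (Gamma_weak r0' _ GG); rewrite le_max lexx orbT ge_max (ltW r1) (ltW r1').
Qed.

Definition deg_le F (d : nat) := forall i : int, d%:Z < i -> F i = 0.

Lemma deg_leM F G d e : deg_le F d -> deg_le G e -> deg_le (F * G) (d + e).
Proof.
move=> hF hG n hn; rewrite hcoefM /smul (zsum_finite cu (s := [::])) ?big_nil //.
move=> i _; have [/hF ->|hi] := ltrP d%:Z i; first by rewrite mul0r.
by rewrite hG ?mulr0 //; lia.
Qed.

Lemma deg_leX F d m : deg_le F d -> deg_le (F ^+ m) (d * m).
Proof.
move=> h; elim: m => [|m IH].
  by move=> i; rewrite muln0 expr0 hcoef1 /sone /sconst; case: eqP => // ->.
by rewrite exprS mulnS; apply: deg_leM.
Qed.

Lemma deg_leZ a F d : deg_le F d -> deg_le (hconst a * F) d.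
Proof. by move=> h i hi; rewrite hcoefZ /sscale h // mulr0. Qed.

(** A term that reaches exponent [i] has [pospart i <= d * m], so its size is at most
    [s^m <= rho^(d m) <= rho^(pospart i)]. The case [d = 0], [rho = 0] is allowed and yields
    membership in [Gamma_ 0]. *)
Lemma exp_Gamma (s rho : R) F E d : 0 <= s < 1 -> 0 <= rho <= 1 -> s <= rho ^+ d ->
  exp_dom s F -> deg_le F d -> is_exp s F E -> Gamma_ abs rho E.
Proof.
move=> s01 r01 sr dF dg hE; apply/(Gamma_P _ r01).
have [s0 s1] := andP s01; have [r0 r1] := andP r01; split.
  (* The one-term partial sum is 1, so the constant coefficient of [E] differs from 1 by at most
     [s < 1]. *)
  have := hE 1%N 0; rewrite expr1 /expN big_ord1 /expT fact0 invr1 rmorph1 mul1r expr0.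
  rewrite hcoefD hcoefN hcoef1 => h.
  rewrite -[RHS]ul1; apply: (ultra_eq age0 aeq0 aM aD); rewrite ul1.
  exact: le_lt_trans h s1.
move=> i.
have hN N : abs (expN F N i) <= rho ^+ pospart i.
  have -> : expN F N i = \sum_(m < N) expT F m i.
    by rewrite /expN hcoef_sum; elim/big_rec2: _ => // m y z _ <-.
  apply: (ultra_sum aeq0 aD) => [|m _]; first exact: exprn_ge0.
  have [le|gt] := leqP (pospart i) (d * m).
    apply: le_trans (dF m i) _; apply: (@le_trans _ _ (rho ^+ (d * m))).
      by rewrite exprM; apply: lerXn2r => //; rewrite nnegrE exprn_ge0.
    exact: ler_wiXn2l.
  rewrite (deg_leZ _ (deg_leX (m := m) dg)) ?ul0 ?exprn_ge0 //.
  by move: gt; have := pospartP i; clear; lia.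
rewrite leNgt; apply/negP => lt.
have E0 : 0 < abs (E i) by apply: le_lt_trans lt; exact: exprn_ge0.
have [N /(_ N (leqnn _)) sN] := expr_small s01 E0.
have : abs (E i) < abs (E i); last by rewrite ltxx.
rewrite -{1}(subrK (expN F N i) (E i)); apply: (ultra_lt aD).
  by rewrite ulC; apply: le_lt_trans sN; apply: hE.
exact: le_lt_trans (hN N) lt.
Qed.

Lemma root_lt1 (s : R) d : 0 <= s < 1 ->
  exists2 rho : R, 0 <= rho < 1 & s <= rho ^+ d.+1.
Proof.
move=> /andP[s0 s1]; exists (s `^ (d.+1%:R)^-1).
  rewrite powR_ge0 /= ltNge; apply/negP => h.
  have := exprn_ege1 d.+1 h.
  by rewrite -powR_mulrn ?powR_ge0 // -powRrM mulVf ?pnatr_eq0 // powRr1 // leNgt s1.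
by rewrite -powR_mulrn ?powR_ge0 // -powRrM mulVf ?pnatr_eq0 // powRr1.
Qed.

(** [A] is closed under the finite product [lmul], while [H] carries the limit product [smul]; this
    lets powers taken in [H] stay in [A]. *)
Lemma smul_lmul f g : laurent f -> laurent g -> smul abs f g = lmul f g.
Proof.
move=> [a fa] [b gb]; apply/funext => n; rewrite /smul /lmul.
pose s := zwin (absz a + absz b + absz n).+1.
have hs i : i \notin s -> f i * g (n - i) = 0.
  move=> /zwinPn hi; have [/fa ->|ai] := ltrP a i; first by rewrite mul0r.
  by rewrite gb ?mulr0 //; move: hi ai; clear; lia.
rewrite (zsum_finite cu (zwin_uniq _) hs) fsbig_seq ?zwin_uniq //.
by apply: fsbig_widen => // i [_ /= /negP/hs].
Qed.

(** * The closure of [A] and cosets in [Gamma] *)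

Section Algebra.
Context (A : set (int -> K)) (A_alg : subalgebra A).

Lemma subalg0 : A 0.
Proof.
have [_ A1 AZ _] := A_alg; have := AZ (-1) _ _ A1 A1; congr A.
apply/funext => i; change (-1 * sone K i + sone K i = 0).
by rewrite mulN1r addNr.
Qed.

Lemma subalgZ a f : A f -> A (sscale a f).
Proof. by have [_ _ AZ _] := A_alg => Af; have := AZ a _ _ Af subalg0; rewrite addr0. Qed.

Lemma subalgD f g : A f -> A g -> A (f + g).
Proof.
have [_ _ AZ _] := A_alg => Af Ag; have := AZ 1 _ _ Af Ag; congr (A (_ + _)).
by apply/funext => i; rewrite /sscale mul1r.
Qed.

Lemma subalgM F G : A F -> A G -> A (F * G : HT).
Proof.
have [AL _ _ AM] := A_alg => AF AG.
by rewrite hcoefM smul_lmul; [apply: AM|apply: AL|apply: AL].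
Qed.

Lemma subalgX F m : A F -> A (F ^+ m : HT).
Proof.
move=> AF; elim: m => [|m IH]; last by rewrite exprS; apply: subalgM.
by rewrite expr0 hcoef1; case: A_alg.
Qed.

Lemma subalg_expN F N : A F -> A (expN F N).
Proof.
move=> AF; rewrite hcoef_sum; apply: big_ind; [exact: subalg0|exact: subalgD|].
by move=> m _; rewrite hcoefZ; apply/subalgZ/subalgX.
Qed.

Lemma an_P F : an abs A F <-> forall e, 0 < e -> exists2 G, A (hcoef G) & hle (F - G) e.
Proof.
split=> [[HF h] e e0|h].
  have [g [Ag Hg lt]] := h e e0; exists (HSer cu Hg) => //.
  by apply: hle_weak (ltW lt) _; apply: (@snorm_hle _ _ _ cu (F - HSer cu Hg)).
split=> [|e e0]; first exact: hcoefP.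
have [|G AG hG] := h (e / 2); first lra.
exists (hcoef G); split=> //; first exact: hcoefP.
by apply: (@le_lt_trans _ _ (e / 2)); [apply: snorm_le|lra].
Qed.

Lemma anM F G : an abs A F -> an abs A G -> an abs A (F * G : HT).
Proof.
move=> /an_P hF /an_P hG; apply/an_P => e e0.
have [M M1 FM] := H_bounded (hcoefP F); have [M' M1' GM] := H_bounded (hcoefP G).
pose d := e / (M * M').
have MM : 1 <= M * M' by nra.
have d0 : 0 < d by apply: divr_gt0 => //; lra.
(* The cap at 1 keeps the approximant [F'] bounded by the same [M] as [F]. *)
have m0 : 0 < Num.min d 1 by rewrite lt_min d0 ltr01.
have [F' AF' dF] := hF _ m0; have [G' AG' dG] := hG _ m0.
have F'M : hle F' M.
  rewrite -[F'](subrK F); apply: hleD => //; apply: hleBC.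
  by apply: hle_weak dF; apply: le_trans M1; rewrite ge_min lexx orbT.
have dMM : d * (M * M') = e by rewrite /d divfK // gt_eqF //; lra.
exists (F' * G'); first exact: subalgM.
have le1 c : 1 <= c -> c <= M * M' -> Num.min d 1 * c <= e.
  move=> c1 cM; rewrite -dMM; apply: ler_pM => //; [exact: ltW|lra|].
  by rewrite ge_min lexx.
apply: (hle_dist (G := F' * G)).
  rewrite -mulrBl; apply: hle_weak (hleM dF GM); apply: le1 => //; nra.
rewrite -mulrBr; apply: hle_weak (hleM F'M dG).
by rewrite mulrC; apply: le1 => //; nra.
Qed.

Lemma an_exp (s : R) F E : 0 <= s < 1 -> A F -> is_exp s F E -> an abs A E.
Proof.
move=> s01 AF hE; apply/an_P => e e0.
have [N /(_ N (leqnn _)) /ltW sN] := expr_small s01 e0.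
exists (expN F N); first exact: subalg_expN.
by apply/hleBC/(hle_weak sN).
Qed.

Lemma Gamma_sub_mul F G u : an_units abs A F -> Gamma abs F -> Gamma_ abs 0 G ->
  Gamma_sub abs A u -> Gamma_sub abs A (smul abs (F * G : HT) u).
Proof.
move=> [aF [f' af' Ff']] GF GG [a [[aa [a' aa' aa'1]] Ga] [g Gg <-]].
have [Hf' _] := af'; have [Ha _] := aa; have [Ha' _] := aa'.
have [Hg _ _ _ _] := Gg.
pose F' := HSer cu Hf'; pose X := HSer cu Ha; pose X' := HSer cu Ha'.
pose Y := HSer cu Hg.
have FF' : F * F' = 1 by apply: hcoef_inj.
have XX' : X * X' = 1 by apply: hcoef_inj.
exists (hcoef (F * X)).
  split; last exact: (@Gamma_mulr F X).
  split; first exact: (@anM F X).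
  exists (hcoef (F' * X')); first exact: (@anM F' X').
  by rewrite -hcoefM mulrACA FF' XX' mulr1.
exists (hcoef (G * Y)); first by apply: (@Gamma_mul 0 G Y) => //; rewrite lexx ltr01.
change (hcoef (F * X * (G * Y)) = hcoef (F * G * (X * Y))).
by rewrite mulrACA.
Qed.

(** Classes are cosets, that is sets, so two inclusions are needed: one multiplies the subgroup
    element by [F * G], the other by its inverse [F' * G']. *)
Lemma Gamma_class_trivial F F' G G' : F * F' = 1 -> G * G' = 1 ->
  an abs A F -> an abs A F' -> Gamma abs F -> Gamma abs F' ->
  Gamma_ abs 0 G -> Gamma_ abs 0 G' ->
  Gamma_class abs A (F * G : HT) = Gamma_class abs A (sone K).
Proof.
move=> FF GG aF aF' gF gF' gG gG'.
have uF : an_units abs A F.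
  by split=> //; exists (hcoef F') => //; rewrite -hcoefM FF.
have uF' : an_units abs A F'.
  by split=> //; exists (hcoef F) => //; rewrite -hcoefM mulrC FF.
have uH u : Gamma_sub abs A u -> H abs u.
  move=> [a [[[Ha _] _] _] [g [Hg _ _ _ _] <-]]; exact: (H_smul cu).
apply/seteqP; split=> _ [u hu <-].
  exists (smul abs (F * G : HT) u); first exact: Gamma_sub_mul.
  have Hu := uH _ hu; pose U := HSer cu Hu.
  change (hcoef (1 * (F * G * U)) = hcoef (F * G * U)).
  by rewrite mul1r.
exists (smul abs (F' * G' : HT) u); first exact: Gamma_sub_mul.
have Hu := uH _ hu; pose U := HSer cu Hu.
change (hcoef (F * G * (F' * G' * U)) = hcoef (1 * U)).
by rewrite mulrA mulrACA FF GG mulr1.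
Qed.

End Algebra.

Lemma series_cvg (t : nat -> K) (B : R) :
  (forall e, 0 < e -> exists N, forall k, (N <= k)%N -> abs (t k) <= e) ->
  (forall k, abs (t k) <= B) ->
  exists2 l, K_cvg abs (fun N => \sum_(k < N) t k) l & abs l <= B.
Proof.
move=> ht tB.
have B0 : 0 <= B by apply: le_trans (tB 0%N).
have [l hl] : exists l, K_cvg abs (fun N => \sum_(k < N) t k) l.
  apply: (cu_complete cu) => e e0.
  have [|N hN] := ht (e / 2); first lra.
  exists N => m n Nm Nn; apply: (@le_lt_trans _ _ (e / 2)); last lra.
  have key M : (N <= M)%N -> abs (\sum_(k < M) t k - \sum_(k < N) t k) <= e / 2.
    move=> NM; rewrite -!(big_mkord xpredT t) (@big_cat_nat _ _ _ N 0 M) //=.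
    rewrite addrAC subrr add0r.
    apply: (ultra_sum_in aeq0 aD) => [|k]; first lra.
    by rewrite mem_index_iota => /andP[Nk _]; apply: hN.
  apply: (ultra_dist aD (key m Nm)); rewrite ulC; exact: key.
exists l => //; rewrite -[l]subr0.
apply: (ultra_le_lim age0 aeq0 aM aD (N := 0%N) hl) => n _.
by rewrite subr0; apply: (ultra_sum aeq0 aD).
Qed.

(** All terms of the series in the exponent are multiples of one element, so its convergence in [H]
    is that of a scalar series. *)
Lemma H_has_sum_scale (t : nat -> K) l F : K_cvg abs (fun N => \sum_(k < N) t k) l ->
  hle F 1 -> H_has_sum abs (fun k => sscale (t k) F) (hcoef (hconst l * F)).
Proof.
move=> hl F1.
have eN N : \sum_(k < N) sscale (t k) F = hcoef (hconst (\sum_(k < N) t k) * F).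
  by rewrite rmorph_sum mulr_suml hcoef_sum; apply: eq_bigr => k _; rewrite hcoefZ.
split=> [N||e e0]; [by rewrite eN; apply: hcoefP|exact: hcoefP|].
have [|N hN] := hl (e / 2); first lra.
exists N => n /hN /ltW h; rewrite eN; apply: (@le_lt_trans _ _ (e / 2)); last lra.
apply: snorm_le => i.
have : hle (hconst (\sum_(k < n) t k) * F - hconst l * F) (e / 2 * 1).
  rewrite -mulrBl -rmorphB; apply: hleM => //; apply: hle_weak h _; exact: hle_const.
by rewrite mulr1; apply.
Qed.

End Gamma.

(** Legendre's formula, by a telescoping induction: the extra summand [m %/ p ^ N] pays for the next
    one because [p * (m %/ p ^ N.+1) <= m %/ p ^ N]. *)
Lemma logn_fact_le p m : prime p -> (p.-1 * logn p m`! <= m)%N.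
Proof.
move=> p_pr; rewrite logn_fact //.
suff key N : (p.-1 * (\sum_(1 <= k < N.+1) m %/ p ^ k) + m %/ p ^ N <= m)%N.
  exact: leq_trans (leq_addr _ _) (key m).
elim: N => [|N IH]; first by rewrite big_geq // muln0 expn0 divn1.
apply: leq_trans IH; rewrite big_nat_recr //= mulnDr -addnA leq_add2l.
rewrite -[X in (_ + X)%N]mul1n -mulnDl addn1 prednK ?prime_gt0 //.
by rewrite expnSr divnMA mulnC leq_divM.
Qed.

(** * Factorials and the radius of convergence of the exponential *)

Section Numerics.
Context (R : realType) (K : fieldType) (abs : K -> R) (cu : complete_ultra abs).
Let age0 := cu_ge0 cu.
Let aeq0 := cu_eq0 cu.
Let aM := cu_M cu.
Let aD := cu_D cu.
Context (p : nat) (p_pr : prime p) (p_lt1 : abs p%:R < 1) (p_gt0 : 0 < abs p%:R).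
Let r : R := abs p%:R `^ (p.-1%:R)^-1.
Let p1 : (0 < p.-1)%N. Proof. by have := prime_gt1 p_pr; case: (p) => // -[]. Qed.

Lemma crit_gt0 : 0 < r. Proof. exact: powR_gt0. Qed.
Lemma critX : r ^+ p.-1 = abs p%:R.
Proof.
rewrite -powR_mulrn ?powR_ge0 // -powRrM mulVf ?powRr1 ?ltW //.
by rewrite pnatr_eq0 -lt0n.
Qed.
Lemma crit_lt1 : r < 1.
Proof.
rewrite ltNge; apply/negP => h; have := exprn_ege1 p.-1 h.
by rewrite critX leNgt p_lt1.
Qed.

(** The prime-to-[p] part of [m!] has absolute value 1, so [|m!| = |p|^v = r^((p-1) v)] with
    [(p-1) v <= m]. *)
Lemma abs_fact_ge m : r ^+ m <= abs (m`!)%:R.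
Proof.
have [q cq e] := pfactor_coprime p_pr (fact_gt0 m).
rewrite e natrM natrX aM (ultraX aeq0 aM).
rewrite (ultra_coprime age0 aeq0 aM aD p_lt1) ?mul1r; last 2 first.
- by rewrite lt0n; apply: contraTneq (fact_gt0 m) => q0; rewrite e q0 mul0n.
- by rewrite coprime_sym.
rewrite -critX -exprM; apply: ler_wiXn2l; [exact/ltW/crit_gt0|exact/ltW/crit_lt1|].
exact: logn_fact_le.
Qed.

Lemma fact_neq0_ultra m : (m`!)%:R != 0 :> K.
Proof.
rewrite -(ultra_gt0 age0 aeq0); apply: lt_le_trans (abs_fact_ge m).
exact: exprn_gt0 crit_gt0.
Qed.

Lemma exp_dom_scale (s : R) x (F : Hser cu) : 0 <= s -> abs x <= s * r -> hle F 1 ->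
  exp_dom s (hconst cu x * F).
Proof.
move=> s0 xs F1 m; rewrite /expT exprMn -rmorphXn mulrA -rmorphM -[s ^+ m]mulr1.
apply: hleM; last by rewrite -[X in hle _ X](expr1n R m); apply: hleX.
apply: hle_weak (hle_const _ _).
rewrite aM (ultraV age0 aeq0 aM) (ultraX aeq0 aM) mulrC.
have f0 : 0 < abs (m`!)%:R by rewrite (ultra_gt0 age0 aeq0) fact_neq0_ultra.
rewrite ler_pdivrMr //; apply: (@le_trans _ _ (s ^+ m * r ^+ m)).
  rewrite -exprMn; apply: lerXn2r => //; rewrite ?nnegrE //.
  by apply: mulr_ge0 => //; exact/ltW/crit_gt0.
by apply: ler_wpM2l; [exact: exprn_ge0|exact: abs_fact_ge].
Qed.

(** * The scalar series in the exponent *)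

Section Terms.
Context (n : nat) (pi : K).
Hypothesis pi_lt1 : abs pi < 1.
Hypothesis pi_crit : abs pi ^+ (p ^ n) <= r.

(** The first bound keeps the exponent [p^j - (p-1) j] at least 1, for the uniform estimate; the
    second makes it at least [j], for convergence. *)
Lemma expn_ge_lin j : (p.-1 * j + 1 <= p ^ j)%N /\ (p.-1 * j + j <= p ^ j)%N.
Proof.
have p2 := prime_gt1 p_pr.
have key k : (p.-1 * k + 1 <= p ^ k)%N.
  elim: k => [|k IH]; first by rewrite muln0 expn0.
  rewrite expnS; apply: (@leq_trans (p * (p.-1 * k + 1))); last by rewrite leq_mul2l IH orbT.
  by move: p2 p1; case: (p) => // q; nia.
split=> //; case: j => [|j]; first by rewrite muln0 expn0.
have := key j; rewrite expnS; move: p2 p1; case: (p) => [|[|q]] //= _ _ h.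
apply: (@leq_trans (q.+2 * (q.+1 * j + 1))); last by rewrite leq_mul2l h orbT.
by nia.
Qed.

(** Here [n] stands for the [n - 1] of the theorem. The numerator is at most [r^(p^j)], and
    [|p|^j = r^((p-1) j)] is absorbed into it. *)
Lemma term_late j :
  abs (pi ^+ (p ^ (n + j)) / p%:R ^+ (n + j)) <=
  r ^+ (p ^ j - p.-1 * j) / abs p%:R ^+ n.
Proof.
have [le1 _] := expn_ge_lin j.
have jp : (p.-1 * j <= p ^ j)%N by apply: leq_trans le1; apply: leq_addr.
rewrite aM (ultraV age0 aeq0 aM) !(ultraX aeq0 aM).
rewrite ler_pdivrMr ?exprn_gt0 // exprD mulrA divfK ?gt_eqF ?exprn_gt0 //.
rewrite -critX -exprM -exprD subnK // expnD exprM.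
by apply: lerXn2r => //; rewrite nnegrE ?exprn_ge0 // ltW // crit_gt0.
Qed.

(** Only [|pi| < 1] is used: [|p|^-k <= |p| / |p|^n], and [|p| = r^(p-1) <= r]. *)
Lemma term_early k : (k < n)%N ->
  abs (pi ^+ (p ^ k) / p%:R ^+ k) <= r / abs p%:R ^+ n.
Proof.
move=> kn; rewrite aM (ultraV age0 aeq0 aM) !(ultraX aeq0 aM).
rewrite ler_pdivrMr ?exprn_gt0 // mulrAC ler_pdivlMr ?exprn_gt0 //.
apply: (@le_trans _ _ (abs p%:R ^+ n)).
  by rewrite ler_piMl ?exprn_ge0 // exprn_ile1 // ltW.
apply: (@le_trans _ _ (abs p%:R ^+ k.+1)); first by apply: ler_wiXn2l => //; apply: ltW.
rewrite exprS; apply: ler_wpM2r; first exact: exprn_ge0.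
rewrite -critX -[X in _ <= X]expr1; apply: ler_wiXn2l => //; apply: ltW.
  exact: crit_gt0.
exact: crit_lt1.
Qed.

Lemma term_le k : abs (pi ^+ (p ^ k) / p%:R ^+ k) <= r / abs p%:R ^+ n.
Proof.
have [kn|nk] := ltnP k n; first exact: term_early.
rewrite -(subnKC nk); set j := (k - n)%N; apply: le_trans (term_late j) _.
apply: ler_wpM2r; first by rewrite invr_ge0 exprn_ge0.
rewrite -[X in _ <= X]expr1; apply: ler_wiXn2l; [exact/ltW/crit_gt0|exact/ltW/crit_lt1|].
by have [le1 _] := expn_ge_lin j; rewrite leq_subRL //; apply: leq_trans le1; apply: leq_addr.
Qed.

Lemma term_small e : 0 < e ->
  exists N, forall k, (N <= k)%N -> abs (pi ^+ (p ^ k) / p%:R ^+ k) <= e.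
Proof.
move=> e0; have pn0 : 0 < abs p%:R ^+ n by apply: exprn_gt0.
have r01 : 0 <= r < 1 by rewrite ltW ?crit_gt0 ?crit_lt1.
have [N hN] := expr_small r01 (mulr_gt0 e0 pn0).
exists (n + N)%N => k Nk; have nk : (n <= k)%N by apply: leq_trans Nk; apply: leq_addr.
rewrite -(subnKC nk); set j := (k - n)%N; apply: le_trans (term_late j) _.
rewrite ler_pdivrMr //; apply: ltW; apply: hN.
have [_ le2] := expn_ge_lin j.
apply: (@leq_trans j); first by rewrite /j leq_subRL.
by rewrite leq_subRL //; apply: leq_trans le2; apply: leq_addr.
Qed.

End Terms.

End Numerics.

Theorem lemma3p10 (p : nat) (p_pr : prime p) (R : realType)
    (K : fieldExtType (padic p_pr)) (abs : K -> R)
    (abs_padic : is_padic_abs abs)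
    (A : set (int -> K))
    (A_alg : subalgebra A)
    (A_const : A `&` @power_series K = range (@sconst K))
    (A_codim : finite_codim A)
    (A_int : strictly_integral abs A)
    (b : int -> K)
    (b_in : exists f g : int -> K,
       [/\ integral_part abs A f, int_power_series_max abs g & b = f + g])
    (n : nat) (n_gt0 : (0 < n)%N)
    (c pi : K) (c_M : M_K abs c) (pi_M : M_K abs pi)
    (c_lt : abs c < abs (p%:R ^+ n.-1))
    (pi_le : abs pi <= abs p%:R `^ (p%:R ^+ n - p%:R ^+ n.-1)^-1) :
  exists g h : int -> K,
    [/\ H_has_sum abs
          (fun k => sscale (pi ^+ (p ^ k) / p%:R ^+ k) b) g,
        H_has_exp abs (sscale c g) h,
        Gamma abs h &
        Gamma_class abs A h = Gamma_class abs A (sone K)].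
Proof.
have cu := padic_complete_ultra abs_padic.
have p2 : 1 < p%:R :> R by rewrite ltr1n prime_gt1.
have p0 : 0 < p%:R :> R by lra.
have pgt0 : 0 < abs p%:R by rewrite (padic_abs_p_ext abs_padic) invr_gt0.
have plt1 : abs p%:R < 1 by rewrite (padic_abs_p_ext abs_padic) invf_lt1.
have aX := ultraX (cu_eq0 cu) (cu_M cu).
pose r : R := abs p%:R `^ (p.-1%:R)^-1.
have r0 : 0 < r := powR_gt0 _ pgt0.
have pi_crit : abs pi ^+ (p ^ n.-1) <= r.
  apply: (@le_trans _ _ ((abs p%:R `^ (p%:R ^+ n - p%:R ^+ n.-1)^-1) ^+ (p ^ n.-1))).
    by apply: lerXn2r => //; rewrite nnegrE ?(cu_ge0 cu) ?powR_ge0.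
  rewrite -powR_mulrn ?powR_ge0 // -powRrM natrX /r.
  suff -> : (p%:R ^+ n - p%:R ^+ n.-1)^-1 * p%:R ^+ n.-1 = (p.-1%:R)^-1 :> R by [].
  have e : p%:R ^+ n - p%:R ^+ n.-1 = p.-1%:R * p%:R ^+ n.-1 :> R.
    rewrite -{1}(prednK n_gt0) exprS -(subn1 p) natrB ?prime_gt0 //.
    by rewrite mulrBl mul1r.
  by rewrite e invfM -mulrA mulVf ?mulr1 // expf_neq0 // gt_eqF.
have [f [g [[Af Of] [g0 Og] bE]]] := b_in.
have [AL _ _ _] := A_alg; have [df fdf] := AL _ Af.
pose d := (absz df).+1.
have Hf : H abs f.
  split; first by exists 1 => i; apply: Of.
  by move=> e e0; exists (df + 1) => i hi; rewrite fdf ?(ultra0 (cu_eq0 cu)) //; move: hi; clear; lia.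
have Hg : H abs g.
  split; first by exists 1 => i; apply: Og.
  by move=> e e0; exists 0 => i hi; rewrite g0 ?(ultra0 (cu_eq0 cu)).
pose F := HSer cu Hf; pose G := HSer cu Hg.
have F1 : hle F 1 by move=> i; apply: Of.
have G1 : hle G 1 by move=> i; apply: Og.
have bFG : b = hcoef (F + G) by [].
have pn0 : 0 < abs p%:R ^+ n.-1 by apply: exprn_gt0.
have [l hl l_le] := series_cvg cu
  (term_small cu p_pr plt1 pgt0 pi_M pi_crit) (term_le cu p_pr plt1 pgt0 pi_M pi_crit).
pose x := c * l.
(* The scalar sum [l] satisfies [|l| <= r / |p|^(n-1)], so this ratio gives [|c l| <= s * r];
   [s < 1] is the strict hypothesis on [c]. *)
pose s := abs c / abs p%:R ^+ n.-1.
have s01 : 0 <= s < 1.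
  by rewrite divr_ge0 ?(cu_ge0 cu) ?ltW //= ltr_pdivrMr // mul1r -aX.
have [s0 /ltW s1] := andP s01.
have xs : abs x <= s * r.
  rewrite (cu_M cu) /s mulrAC -mulrA; apply: ler_wpM2l => //; exact: (cu_ge0 cu).
have xNs : abs (- x) <= s * r.
  by rewrite (ultraN (cu_ge0 cu) (cu_eq0 cu) (cu_M cu)).
have fact0 := fact_neq0_ultra cu p_pr plt1 pgt0.
have dom y (X : Hser cu) : abs y <= s * r -> hle X 1 -> exp_dom s (hconst cu y * X).
  exact: exp_dom_scale.
have [EF hEF] := is_exp_exists s01 (dom _ _ xs F1).
have [EF' hEF'] := is_exp_exists s01 (dom _ _ xNs F1).
have [EG hEG] := is_exp_exists s01 (dom _ _ xs G1).
have [EG' hEG'] := is_exp_exists s01 (dom _ _ xNs G1).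
have inv X (X1 : hle X 1) E E' : is_exp s (hconst cu x * X) E ->
    is_exp s (hconst cu (- x) * X) E' -> E * E' = 1.
  rewrite rmorphN mulNr => h h'; apply: (is_exp_opp s01 fact0 _ _ h h').
    exact: dom.
  by rewrite -mulNr -rmorphN; apply: dom.
have degF : deg_le F d by move=> i hi; apply: fdf; move: hi; rewrite /d; clear; lia.
have degG : deg_le G 0 by move=> i hi; apply: g0; apply: ltW.
have [rho rho01 srho] := root_lt1 (absz df) s01.
have rho01' : 0 <= rho <= 1 by case/andP: rho01 => -> /ltW ->.
have GF y E : abs y <= s * r -> is_exp s (hconst cu y * F) E -> Gamma abs E.
  move=> ys hE; exists rho => //.
  exact: exp_Gamma s01 rho01' srho (dom _ _ ys F1) (deg_leZ _ degF) hE.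
(* [G] has no positive powers of [T], so degree bound 0 works and [rho] can be 0. *)
have G0 y E : abs y <= s * r -> is_exp s (hconst cu y * G) E -> Gamma_ abs 0 E.
  move=> ys hE.
  apply: (exp_Gamma s01 _ _ (dom _ _ ys G1) (deg_leZ _ degG) hE).
    by rewrite lexx ler01.
  by rewrite expr0.
have aF y E : is_exp s (hconst cu y * F) E -> an abs A E.
  by apply: an_exp => //; rewrite hcoefZ; apply: subalgZ.
(* The exponential of the full series is produced directly as the product of the two separate
   exponentials. *)
exists (hcoef (hconst cu l * (F + G))), (hcoef (EF * EG)); split.
- by rewrite bFG; apply: H_has_sum_scale => //; apply: hleD.
- rewrite -hcoefZ mulrA -rmorphM -/x mulrDr; apply: (is_exp_H s01).
  exact: is_exp_add (dom _ _ xs F1) (dom _ _ xs G1) hEF hEG.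
- apply: Gamma_mulr; first exact: GF hEF.
  by exists 0; [rewrite /= lexx ltr01|exact: G0 hEG].
- apply: (Gamma_class_trivial A_alg (F' := EF') (G' := EG')).
  + exact: (inv F F1).
  + exact: (inv G G1).
  + exact: aF hEF.
  + exact: aF hEF'.
  + exact: GF hEF.
  + exact: GF hEF'.
  + exact: G0 hEG.
  + exact: G0 hEG'.
Qed.
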